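(* Let $R$ be a commutative ring with $1$ which is $\mathbb S$-torsion-free and $\mathbb S$-reduced, with $|R|<2^{\aleph_0}$. Let $K$ be any $\mathbb S$-torsion-free and $\mathbb S$-reduced $R$-module of rank $\kappa<2^{\aleph_0}$ (with $\kappa\ge 1$). Then there is a cotorsion-free $R$-module $G$, of rank $3$ if $\kappa=1$ and of rank $3\kappa+1$ if $2\le\kappa<2^{\aleph_0}$, containing $K$ as a submodule, such that $\mathrm{Hom}_R(G,K)=0$ and $\mathrm{Hom}_R(G,G/K)=\pi R$, where $\pi\colon G\to G/K$, $g\mapsto g+K$, is the canonical epimorphism. In particular, $0\to K\to G\to G/K\to 0$ is a cellular exact sequence.
   Context: $R$ has a distinguished countable multiplicatively closed subset $\mathbb S=\{s_n:n\in\omega\}$; ''torsion'', ''reduced'', ''pure'' refer to $\mathbb S$. $\widehat R$ is the $\mathbb S$-adic completion of $R$, and an $R$-module $M$ is cotorsion-free if $\mathrm{Hom}_R(\widehat R,M)=0$. Rank: if $|M|>|R|$ then $\mathrm{rk}(M)=|M|$; if $|M|\le|R|$, $\mathrm{rk}(M)=\kappa$ means there is a free submodule $E=\bigoplus_{i<\kappa}Re_i\subseteq M$ with $M/E$ $\mathbb S$-torsion (every element annihilated by some $s\in\mathbb S$). $\pi R$ denotes $\{\pi r: r\in R\}$ where $\pi r$ is $\pi$ followed by multiplication by $r$. A cellular exact sequence $0\to K\to G\xrightarrow{\pi} M\to 0$ is a short exact sequence in which $\pi_*\colon\mathrm{Hom}_R(G,G)\to\mathrm{Hom}_R(G,M)$,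 $\varphi\mapsto\pi\varphi$, is an isomorphism. *)

(* Defs.v *)
From HB Require Import structures.
From mathcomp Require Import all_boot all_order all_algebra.
Set Implicit Arguments. Unset Strict Implicit. Unset Printing Implicit Defensive.
Import GRing.Theory.
Local Open Scope ring_scope.

(* The distinguished countable multiplicatively closed subset S is given by an
   enumeration s : nat -> R, S = range s. *)

Definition card_le (A B : Type) : Prop := exists f : A -> B, injective f.
Definition card_lt (A B : Type) : Prop := card_le A B /\ ~ card_le B A.
Definition card_eq (A B : Type) : Prop := exists f : A -> B, bijective f.

Section SDefs.
Variables (R : comNzRingType) (s : nat -> R).

Definition mult_closed : Prop :=
  (exists n, s n = 1) /\ (forall i j, exists k, s k = s i * s j).

Definition S_torsion_free (M : lmodType R) : Prop :=
  forall (n : nat) (m : M), s n *: m = 0 -> m = 0.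

Definition S_reduced (M : lmodType R) : Prop :=
  forall m : M, (forall n, exists m' : M, m = s n *: m') -> m = 0.

Definition lin_indep (M : lmodType R) (I : eqType) (e : I -> M) : Prop :=
  forall (l : seq I) (c : I -> R), uniq l ->
    \sum_(i <- l) c i *: e i = 0 -> forall i, i \in l -> c i = 0.

Definition in_span (M : lmodType R) (I : eqType) (e : I -> M) (m : M) : Prop :=
  exists (l : seq I) (c : I -> R), m = \sum_(i <- l) c i *: e i.

Definition has_rank (M : lmodType R) (I : eqType) : Prop :=
  (card_lt R M /\ card_eq M I) \/
  (card_le M R /\ exists e : I -> M,
      lin_indep e /\ forall m : M, exists n, in_span e (s n *: m)).

(* q n = s_0 s_1 ... s_n ; the ideals q_n R are cofinal among the s R, so
   \widehat R = lim_n R / q_n R. An element of \widehat R is represented by a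
   compatible family x : nat -> R (x (n+1) = x n mod q_n R), two families being
   identified when their difference is null (x n in q_n R for all n). *)
Definition q (n : nat) : R := \prod_(i < n.+1) s i.

Definition compat (x : nat -> R) : Prop :=
  forall n, exists r, x n.+1 - x n = q n * r.

Definition null (x : nat -> R) : Prop :=
  forall n, exists r, x n = q n * r.

(* Hom_R(\widehat R, M) = 0: every R-linear map on compatible families that
   vanishes on null families (i.e. every R-linear map \widehat R -> M) is 0. *)
Definition cotorsion_free (M : lmodType R) : Prop :=
  forall f : (nat -> R) -> M,
    (forall x y, compat x -> compat y ->
        f (fun n => x n + y n) = f x + f y) ->
    (forall (a : R) x, compat x -> f (fun n => a * x n) = a *: f x) ->
    (forall x, compat x -> null x -> f x = 0) ->
    forall x, compat x -> f x = 0.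

End SDefs.

(* Main.v *)
Require Import Defs.
From HB Require Import structures.
From mathcomp Require Import all_boot all_order all_algebra.
From mathcomp Require Import boolp classical_sets functions ring.
From mathcomp Require cardinality.
Set Implicit Arguments. Unset Strict Implicit. Unset Printing Implicit Defensive.
Import GRing.Theory.
Local Open Scope classical_set_scope.

(** Write elements of an S-adic completion as compatible sequences modulo null
    sequences. Let [e_i] be elements spanning [K] up to torsion, and let [G] be the
    pure hull, in the completion of [K + R x], of [K], [x] and the elements
    [y_j = w_j x + w' e_(p j)], for suitable [w_j], [w'] in the completion of [R]
    and a surjection [p] onto the indices of the [e_i]. A homomorphism [f] out of
    [G] is continuous, so [f y_j = w_j (f x) + w' (f e_(p j))]. If one [w_j0]
    satisfies no quadratic equation over [K] and the span of the other [w_j], and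
    [w'] satisfies no linear equation over what was chosen before, this relation
    forces [f e_i = 0] and, for [f : G -> K], [f x = 0], while for [f : G -> G/K]
    it forces [f x] to be a multiple of the image of [x]. Linear independence of
    [1] and the [w_j] makes [K] closed in [G] and gives the rank.

    Generic elements exist by counting: among the [2^aleph0] sums of subsets of a
    sparse series, only finitely many are roots of a given nonzero quadratic
    polynomial (a Vandermonde determinant excludes three roots that agree on a long
    initial segment), and there are fewer than [2^aleph0] polynomials. *)

(** * Cardinal arithmetic *)

Lemma card_le_refl A : card_le A A.
Proof. by exists id. Qed.

Lemma card_le_trans B A C : card_le A B -> card_le B C -> card_le A C.
Proof. by move=> [f fI] [g gI]; exists (g \o f); exact: inj_comp. Qed.

Lemma card_le_prod A B C D : card_le A B -> card_le C D -> card_le (A * C) (B * D).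
Proof.
move=> [f fI] [g gI]; exists (fun x => (f x.1, g x.2)).
by move=> [a c] [a' c'] /= [/fI-> /gI->].
Qed.

Lemma card_eq_le A B : card_eq A B -> card_le A B.
Proof. by move=> [f /bij_inj fI]; exists f. Qed.

Lemma card_eq_sym A B : card_eq A B -> card_eq B A.
Proof. by move=> [f [g fK gK]]; exists g; exists f. Qed.

Lemma card_le_antisym A B : card_le A B -> card_le B A -> card_eq A B.
Proof.
have le_set C D : card_le C D -> cardinality.card_le [set: C] [set: D].
  move=> [f fI].
  have [h] : $|{injfun [set: C] >-> [set: D]}|.
    by apply/cardinality.injfunPex; exists f => // x y _ _ /fI.
  exact: cardinality.inj_card_le h.
move=> /le_set AB /le_set BA.
have /cardinality.card_bijP[f fB] := cardinality.Cantor_Bernstein AB BA.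
pose inT C (c : C) : [set: C]%classic := SigSub (mem_set (I : classical_sets.setT c)).
have inTK C (c : [set: C]%classic) : inT C (val c) = c by exact: val_inj.
have [g fK gK] := fB; exists (val \o f \o inT A).
by exists (val \o g \o inT B) => x /=; rewrite inTK ?fK ?gK.
Qed.

Lemma card_le_sig T (A : T -> Prop) U (g : T -> U) :
  (forall x y, A x -> A y -> g x = g y -> x = y) -> card_le {x | A x} U.
Proof.
move=> gI; exists (fun x => g (sval x)) => -[x Ax] [y Ay] /= /gI E.
by apply: eq_exist; exact: E.
Qed.

(** In the uses of Zorn's lemma below, this lets two facts about the union of a chain be compared
    inside one member of it. *)
Lemma chain_join T (F : set (set T)) u v X Y : total_on F subset ->
  F X -> F Y -> X u -> Y v -> exists2 Z, F Z & Z u /\ Z v.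
Proof.
move=> Ftot FX FY Xu Yv; have [XY|YX] := Ftot _ _ FX FY.
  by exists Y => //; split=> //; exact: XY.
by exists X => //; split=> //; exact: YX.
Qed.

(** Zorn's lemma gives a maximal graph of a partial injection; if it were neither total nor onto,
    one more pair [(a0, b0)] could be added. *)
Lemma card_le_total A B : card_le A B \/ card_le B A.
Proof.
pose P (F : set (A * B)) := (forall a b b', F (a, b) -> F (a, b') -> b = b') /\
   (forall a a' b, F (a, b) -> F (a', b) -> a = a').
have [F FP Ftot|F [[Ff Fi] Fmax]] := @Zorn_bigcup _ P.
  split=> [a b b'|a a' b] [X FX Xu] [Y FY Yv];
    have [Z FZ [Zu Zv]] := chain_join Ftot FX FY Xu Yv; have [Zf Zi] := FP _ FZ.
    exact: Zf Zu Zv.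
  exact: Zi Zu Zv.
have [/choice[f fP]|nA] := pselect (forall a, exists b, F (a, b)).
  by left; exists f => a a' E; apply: (Fi _ _ (f a)) => //; rewrite E.
have [/choice[f fP]|nB] := pselect (forall b, exists a, F (a, b)).
  by right; exists f => b b' E; apply: (Ff (f b)) => //; rewrite E.
have /existsNP[a0 Na0] := nA; have /existsNP[b0 Nb0] := nB.
exfalso; apply: (Fmax (F `|` [set (a0, b0)])).
  split; first by move=> x Fx; left.
  by move=> sub; apply: Na0; exists b0; apply: sub; right.
split=> [a b b'|a a' b] [Fu|/= [? ?]] [Fv|/= [? ?]]; subst => //.
- exact: Ff Fu Fv.
- by case: Na0; exists b.
- by case: Na0; exists b'.
- exact: Fi Fu Fv.
- by case: Nb0; exists a.
- by case: Nb0; exists a'.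
Qed.

Lemma card_le_nat_bool X : card_le nat X -> card_le bool X.
Proof. by apply: card_le_trans; exists nat_of_bool; case; case. Qed.

Lemma card_le_sum_sq A B X : card_le nat X ->
  card_le A X -> card_le B X -> card_le (A + B) (X * X).
Proof.
move=> /card_le_nat_bool [h hI] [f fI] [g gI].
exists (fun u => match u with inl a => (h true, f a) | inr b => (h false, g b) end).
by move=> [a|b] [a'|b'] [] // => [/fI->|/hI|/hI|/gI->].
Qed.

(* Zorn's lemma applied to graphs of injections D * D -> D with D a subset of X
   containing a fixed copy of nat; D F is the set D of the graph F. *)
Lemma card_le_square X : card_le nat X -> card_le (X * X) X.
Proof.
move=> [nu nuI].
pose D (F : set (X * X * X)) x := exists z, F (x, x, z).
pose P (F : set (X * X * X)) :=
  [/\ forall u z z', F (u, z) -> F (u, z') -> z = z',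
      forall u u' z, F (u, z) -> F (u', z) -> u = u',
      forall x y, D F x -> D F y -> exists z, F (x, y, z),
      forall x y z, F (x, y, z) -> [/\ D F x, D F y & D F z] &
      (* The clause is conditional because the empty graph, the union of the empty chain, has to
         satisfy [P]. *)
      F !=set0 -> forall n, D F (nu n)].
have [F FP Ftot|F [[Ff Fi Ft Fd Fnu] Fmax]] := @Zorn_bigcup _ P.
  have Dsub Z x : F Z -> D Z x -> D (\bigcup_(X in F) X) x.
    by move=> FZ [z Zz]; exists z; exists Z.
  split.
  - move=> u z z' [Y FY Yu] [Y' FY' Yv].
    have [Z FZ [Zu Zv]] := chain_join Ftot FY FY' Yu Yv.
    by have [Zf _ _ _ _] := FP _ FZ; exact: Zf Zu Zv.
  - move=> u u' z [Y FY Yu] [Y' FY' Yv].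
    have [Z FZ [Zu Zv]] := chain_join Ftot FY FY' Yu Yv.
    by have [_ Zi _ _ _] := FP _ FZ; exact: Zi Zu Zv.
  - move=> x y [z [Y FY Yu]] [z' [Y' FY' Yv]].
    have [Z FZ [Zu Zv]] := chain_join Ftot FY FY' Yu Yv.
    have [_ _ Zt _ _] := FP _ FZ.
    have [|| t Zxy] := Zt x y; [by exists z | by exists z' |].
    by exists t; exists Z.
  - move=> x y z [Y FY Yu]; have [_ _ _ Yd _] := FP _ FY.
    by have [Dx Dy Dz] := Yd _ _ _ Yu; split; apply: Dsub FY _.
  - move=> [u [Y FY Yu]] n; have [_ _ _ _ Yn] := FP _ FY.
    by apply: Dsub FY _; apply: Yn; exists u.
(* An empty maximal [F] would be properly contained in the graph of the pairing of [nat], copied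
   along [nu]. *)
have {Fnu}Fnu n : D F (nu n).
  apply: Fnu; apply: contrapT => F0.
  pose F' : set (X * X * X) :=
    [set v | exists i j, v = (nu i, nu j, nu (pickle (i, j)))].
  have DF' i : D F' (nu i) by exists (nu (pickle (i, i))), i, i.
  apply: (Fmax F').
    split; first by move=> x Fx; case: F0; exists x.
    move=> sub; apply: F0; exists (nu 0%N, nu 0%N, nu (pickle (0%N, 0%N))).
    by apply: sub; exists 0%N, 0%N.
  split=> //.
  - by move=> u z z' [i [j [-> ->]]] [i' [j' [/nuI-> /nuI-> ->]]].
  - move=> u u' z [i [j [-> ->]]] [i' [j' [-> /nuI/(pcan_inj pickleK)]]].
    by move=> [-> ->].
  - move=> x y [_ [i [_ [-> _ _]]]] [_ [j [_ [-> _ _]]]].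
    by exists (nu (pickle (i, j))), i, j.
  - by move=> x y z [i [j [-> -> ->]]]; split; exact: DF'.
pose A := D F.
have [f fP] : exists f : X -> X -> X, forall x y, A x -> A y -> F (x, y, f x y).
  have /choice[f fP] : forall u : X * X, exists z, A u.1 -> A u.2 -> F (u, z).
    move=> [x y]; have [[Ax Ay]|nA] := pselect (A x /\ A y).
      by have [z Fz] := Ft _ _ Ax Ay; exists z.
    by exists x => Ax Ay; case: nA.
  by exists (fun x y => f (x, y)) => x y Ax Ay; apply: fP.
have fA x y : A x -> A y -> A (f x y) by move=> Ax Ay; have [] := Fd _ _ _ (fP _ _ Ax Ay).
have fI x y x' y' : A x -> A y -> A x' -> A y' -> f x y = f x' y' ->
    x = x' /\ y = y'.
  move=> Ax Ay Ax' Ay' E; have := fP _ _ Ax' Ay'; rewrite -E => /(Fi _ _ _ (fP _ _ Ax Ay)).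
  by case.
have natA : card_le nat {x | A x}.
  by exists (fun n => exist _ (nu n) (Fnu n)) => i j /(congr1 sval)/nuI.
have sqA : card_le ({x | A x} * {x | A x}) {x | A x}.
  exists (fun u => exist _ _ (fA _ _ (svalP u.1) (svalP u.2))).
  move=> [[x Ax] [y Ay]] [[x' Ax'] [y' Ay']] /(congr1 sval)/= /fI.
  by move=> /(_ Ax Ay Ax' Ay')[? ?]; congr (_, _); apply: eq_exist.
(* If the complement of [A] embeds in [A], then [X] embeds in the square of [A], hence in [A].
   Otherwise a copy of [A] outside [A] allows [F] to be enlarged. *)
have [[g gI]|nAle] := card_le_total {x | A x} {x | ~ A x}; last first.
  have XA : card_le X {x | A x}.
    apply: card_le_trans sqA.
    apply: card_le_trans (card_le_sum_sq natA (card_le_refl _) nAle).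
    exists (fun x => match pselect (A x) with
      left Ax => inl (exist _ x Ax) | right Ax => inr (exist _ x Ax) end).
    by move=> x y; case: pselect => Ax; case: pselect => Ay // [].
  apply: card_le_trans (card_le_trans (card_le_prod XA XA) sqA) _.
  exact: (@card_le_sig _ _ _ id).
exfalso.
have [h [hN hI]] : exists h : X -> X, (forall x, A x -> ~ A (h x)) /\
    (forall x y, A x -> A y -> h x = h y -> x = y).
  exists (fun x => match pselect (A x) with
      left Ax => sval (g (exist _ x Ax)) | right _ => x end).
  split=> [x Ax|x y Ax Ay]; case: pselect => //; first by move=> Ax'; case: (g _).
  move=> Ax'; case: pselect => // Ay' E.
  suff /gI/(congr1 sval) : g (exist _ x Ax') = g (exist _ y Ay') by [].
  by case: (g _) (g _) E => u Nu [v Nv] /= E; apply: eq_exist.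
pose e b x := if b then h x else x.
have eN b x : A x -> A (e b x) -> b = false.
  by case: b => // Ax /(hN _ Ax).
have eI b x b' x' : A x -> A x' -> e b x = e b' x' -> b = b' /\ x = x'.
  move=> Ax Ax'; case: b; case: b' => //=; first by move/(hI _ _ Ax Ax').
    by move=> E; case: (hN _ Ax); rewrite E.
  by move=> E; case: (hN _ Ax'); rewrite -E.
(* The new pairs, those with at least one coordinate in the copy [h A], receive values in [h A]. The
   code [c] records which coordinates lie in the copy, so that these values stay distinct. *)
pose c (b b' : bool) := nu (b + b'.*2)%N.
pose N (v : X * X * X) := exists b a b' a', [/\ A a, A a', b || b' &
   v = (e b a, e b' a', h (f (f a a') (c b b')))].
have NN x y z : N (x, y, z) -> A x -> A y -> False.
  by move=> [b [a [b' [a' [Aa Aa' bb' [-> -> _]]]]]] /(eN _ _ Aa) E /(eN _ _ Aa') E';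
    move: bb'; rewrite E E'.
have DF' b a : A a -> D (F `|` N) (e b a).
  case: b => Aa.
    by exists (h (f (f a a) (c true true))); right; exists true, a, true, a.
  by exists (f a a); left; exact: fP.
have FA x y z : F (x, y, z) -> [/\ A x, A y & A z] by exact: Fd.
have D'F x : D (F `|` N) x -> exists b a, A a /\ x = e b a.
  move=> [z [/FA[Ax _ _]|]]; first by exists false, x.
  by move=> [b [a [b' [a' [Aa _ _ [-> _ _]]]]]]; exists b, a.
apply: (Fmax (F `|` N)).
  split; first by move=> x Fx; left.
  move=> sub; have /sub/FA[+ _ _] : (F `|` N) (h (nu 0%N), h (nu 0%N),
      h (f (f (nu 0%N) (nu 0%N)) (c true true))).
    by right; exists true, (nu 0%N), true, (nu 0%N); split=> //; apply: Fnu.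
  by apply/hN; apply: Fnu.
split.
- move=> [x y] z z' [Fz|Nz] [Fz'|Nz']; first exact: Ff Fz Fz'.
  + by have [Ax Ay _] := FA _ _ _ Fz; case: (NN _ _ _ Nz' Ax Ay).
  + by have [Ax Ay _] := FA _ _ _ Fz'; case: (NN _ _ _ Nz Ax Ay).
  move: Nz Nz' => [b [a [b' [a' [Aa Aa' _ [-> -> ->]]]]]].
  move=> [d [g1 [d' [g' [Ag Ag' _ [E1 E2 ->]]]]]].
  by have [-> ->] := eI _ _ _ _ Aa Ag E1; have [-> ->] := eI _ _ _ _ Aa' Ag' E2.
- move=> [x y] [x' y'] z [Fz|Nz] [Fz'|Nz']; first exact: Fi Fz Fz'.
  + have [_ _ Az] := FA _ _ _ Fz; move: Nz' Az => [b [a [b' [a' [Aa Aa' _ [_ _ ->]]]]]].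
    by move=> /(hN _ (fA _ _ (fA _ _ Aa Aa') (Fnu _))).
  + have [_ _ Az] := FA _ _ _ Fz'; move: Nz Az => [b [a [b' [a' [Aa Aa' _ [_ _ ->]]]]]].
    by move=> /(hN _ (fA _ _ (fA _ _ Aa Aa') (Fnu _))).
  move: Nz Nz' => [b [a [b' [a' [Aa Aa' _ [-> -> ->]]]]]].
  move=> [d [g1 [d' [g' [Ag Ag' _ [-> -> E]]]]]].
  have Ac u v : A (c u v) by exact: Fnu.
  have {}E := hI _ _ (fA _ _ (fA _ _ Aa Aa') (Ac _ _)) (fA _ _ (fA _ _ Ag Ag') (Ac _ _)) E.
  have [/fI[]// -> -> /nuI] := fI _ _ _ _ (fA _ _ Aa Aa') (Ac _ _) (fA _ _ Ag Ag') (Ac _ _) E.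
  by clear E; case: b; case: b'; case: d; case: d'.
- move=> x y /D'F[b [a [Aa ->]]] /D'F[b' [a' [Aa' ->]]].
  have [bb'|] := boolP (b || b').
    by exists (h (f (f a a') (c b b'))); right; exists b, a, b', a'.
  by case: b => //; case: b' => // _; exists (f a a'); left; exact: fP.
- move=> x y z [/FA[Ax Ay Az]|].
    by split; [exact: (DF' false)|exact: (DF' false)|exact: (DF' false)].
  move=> [b [a [b' [a' [Aa Aa' _ [-> -> ->]]]]]]; split; try exact: DF'.
  by apply: (DF' true); apply: (fA); [exact: fA|exact: Fnu].
- by move=> _ n; apply: (DF' false); exact: Fnu.
Qed.

Section InfiniteCardinals.
Variable X : Type.
Hypothesis natX : card_le nat X.

Lemma card_le_prodX A B : card_le A X -> card_le B X -> card_le (A * B) X.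
Proof.
by move=> AX BX; exact: card_le_trans (card_le_prod AX BX) (card_le_square natX).
Qed.

Lemma card_le_sumX A B : card_le A X -> card_le B X -> card_le (A + B) X.
Proof.
move=> AX BX; apply: card_le_trans (card_le_square natX).
exact: card_le_sum_sq.
Qed.

Lemma card_le_optionX A : card_le A X -> card_le (option A) X.
Proof.
move=> AX; apply: (@card_le_trans (A + bool)); last first.
  by apply: card_le_sumX => //; exact: card_le_nat_bool.
by exists (fun o => if o is Some a then inl a else inr true) => -[a|] [b|] // [->].
Qed.

(** A list is coded by its length and its iterated pairing; knowing the length makes the pairing
    decodable. *)
Lemma card_le_seqX A : card_le A X -> card_le (seq A) X.
Proof.
move=> [f fI]; have [p pI] := card_le_square natX; have [nu nuI] := natX.
apply: (@card_le_trans (nat * X)); last exact: card_le_prodX (card_le_refl X).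
exists (fun l => (size l, foldr (fun a x => p (f a, x)) (nu 0%N) l)).
elim=> [|a l IH] [|b l'] //= [] sl /pI[/fI-> E].
by rewrite (IH l') //= sl E.
Qed.

End InfiniteCardinals.

Local Open Scope ring_scope.

(** * Submodules and quotient modules *)

Section SubmoduleDef.
Variables (R : comNzRingType) (V : lmodType R) (P : V -> Prop).

Definition submodule := P 0 /\ forall a u v, P u -> P v -> P (a *: u + v).

Hypothesis subP : submodule.

Lemma submodule_closed : submod_closed (fun v => `[< P v >]).
Proof.
have [P0 PD] := subP; split; first exact/asboolP.
by move=> a u v /asboolP Pu /asboolP Pv; apply/asboolP; exact: PD.
Qed.

(* The proof argument is there only to key the closure instances. *)
Definition submod_pred (_ : submodule) : {pred V} := fun v => `[< P v >].

HB.instance Definition _ := GRing.isSubmodClosed.Build R V (submod_pred subP) submodule_closed.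
HB.instance Definition _ := GRing.isOppClosed.Build V (submod_pred subP)
  (GRing.zmod_closedN (GRing.submod_closedB submodule_closed)).

Record submod := Submod { submod_val : V; _ : submod_val \in submod_pred subP }.
HB.instance Definition _ := [isSub for submod_val].
HB.instance Definition _ := [Choice of submod by <:].
HB.instance Definition _ := [SubChoice_isSubLmodule of submod by <:].

Lemma submod_exists : exists (U : lmodType R) (inc : {linear U -> V}),
  injective inc /\ forall v, P v <-> exists u, inc u = v.
Proof.
exists submod, (val : {linear submod -> V}); split; first exact: val_inj.
move=> v; split=> [/asboolP Pv|[[u uP] <-]]; last exact/asboolP.
by exists (Submod Pv).
Qed.

Definition quotmod := Quotient.quot (submod_pred subP : zmodClosed V).
HB.instance Definition _ := GRing.Zmodule.on quotmod.
Local Notation pr := (\pi_quotmod)%qT.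

Definition quotmod_scale (a : R) (x : quotmod) : quotmod := pr (a *: repr x).

Lemma quotmod_eq (u v : V) : (pr u == pr v) = `[< P (u - v) >].
Proof. by rewrite -Quotient.idealrBE. Qed.

Lemma quotmod_scaleE a v : quotmod_scale a (pr v) = pr (a *: v).
Proof.
apply/eqP; rewrite quotmod_eq -scalerBr; have [P0 PD] := subP.
apply/asboolP; rewrite -[_ *: _]addr0; apply: PD => //.
by apply/asboolP; rewrite -quotmod_eq reprK.
Qed.

Lemma quotmod_surj x : exists v, x = pr v.
Proof. by exists (repr x); rewrite reprK. Qed.

Lemma quotmod_scaleA a b x :
  quotmod_scale a (quotmod_scale b x) = quotmod_scale (a * b) x.
Proof. by have [v ->] := quotmod_surj x; rewrite !quotmod_scaleE scalerA. Qed.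

Lemma quotmod_scale1 : left_id 1 quotmod_scale.
Proof. by move=> x; have [v ->] := quotmod_surj x; rewrite quotmod_scaleE scale1r. Qed.

Lemma quotmod_scaleDr : right_distributive quotmod_scale +%R.
Proof.
move=> a x y; have [u ->] := quotmod_surj x; have [v ->] := quotmod_surj y.
by rewrite -raddfD !quotmod_scaleE scalerDr raddfD.
Qed.

Lemma quotmod_scaleDl x : {morph quotmod_scale^~ x : a b / a + b}.
Proof.
move=> a b; have [v ->] := quotmod_surj x.
by rewrite !quotmod_scaleE scalerDl raddfD.
Qed.

HB.instance Definition _ := GRing.Zmodule_isLmodule.Build R quotmod
  quotmod_scaleA quotmod_scale1 quotmod_scaleDr quotmod_scaleDl.

Definition quotmod_pi (v : V) : quotmod := pr v.

Lemma quotmod_pi_linear : linear quotmod_pi.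
Proof. by move=> a u v; rewrite /quotmod_pi raddfD /= -quotmod_scaleE. Qed.
HB.instance Definition _ :=
  GRing.isLinear.Build R V quotmod _ quotmod_pi quotmod_pi_linear.

Lemma quotmod_exists : exists (Q : lmodType R) (pi : {linear V -> Q}),
  (forall y, exists v, pi v = y) /\ forall v, pi v = 0 <-> P v.
Proof.
exists quotmod, (quotmod_pi : {linear V -> quotmod}).
split=> [y|v]; first by have [v ->] := quotmod_surj y; exists v.
have -> : (0 : quotmod) = pr 0 by rewrite raddf0.
split=> [/eqP|Pv]; last by apply/eqP; rewrite quotmod_eq subr0; exact/asboolP.
by rewrite quotmod_eq subr0 => /asboolP.
Qed.

End SubmoduleDef.

(** * Compatible and null sequences *)

Section Divisibility.
Variables (R : comNzRingType) (V : lmodType R).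
Implicit Types (a b : R) (u v : V).

Definition dvm a v := exists u, v = a *: u.

Lemma dvm0 a : dvm a 0.
Proof. by exists 0; rewrite scaler0. Qed.

Lemma dvmD a u v : dvm a u -> dvm a v -> dvm a (u + v).
Proof. by move=> [u' ->] [v' ->]; exists (u' + v'); rewrite scalerDr. Qed.

Lemma dvmZ a b v : dvm a v -> dvm a (b *: v).
Proof. by move=> [u ->]; exists (b *: u); rewrite !scalerA mulrC. Qed.

Lemma dvmN a v : dvm a v -> dvm a (- v).
Proof. by move=> /(dvmZ (-1)); rewrite scaleN1r. Qed.

Lemma dvmB a u v : dvm a u -> dvm a v -> dvm a (u - v).
Proof. by move=> au av; apply: dvmD => //; exact: dvmN. Qed.

Lemma dvm_scale a v : dvm a (a *: v).
Proof. by exists v. Qed.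

Lemma dvm_mulr a b v : dvm (a * b) v -> dvm a v.
Proof. by move=> [u ->]; exists (b *: u); rewrite scalerA. Qed.

End Divisibility.

Section Sequences.
Variables (R : comNzRingType) (s : nat -> R).
Local Notation q := (q s).

Section Convergence.
Variable V : lmodType R.
Implicit Types (u v : nat -> V) (x : nat -> R).

(** [cpt] and [nul] extend [compat] and [null] to modules, and over [R^o] they agree with them by
    conversion. Compatible sequences modulo null ones form the completion of [V]. *)
Definition cpt v := forall n, dvm (q n) (v n.+1 - v n).
Definition nul v := forall n, dvm (q n) (v n).
Definition cst (k : V) : nat -> V := fun=> k.
Definition smul x v : nat -> V := fun n => x n *: v n.

Lemma nul_submodule : submodule nul.
Proof.
split=> [n|a u v nu nv n]; first exact: dvm0.
by apply: dvmD; [exact: dvmZ|exact: nv].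
Qed.

Lemma nulD u v : nul u -> nul v -> nul (u + v).
Proof. by move=> nu nv n; exact: dvmD. Qed.

Lemma nulB u v : nul u -> nul v -> nul (u - v).
Proof. by move=> nu nv n; exact: dvmB. Qed.

Lemma nulZ a v : nul v -> nul (a *: v).
Proof. by move=> nv n; exact: dvmZ. Qed.

Lemma nul_smul x v : nul v -> nul (smul x v).
Proof. by move=> nv n; exact: dvmZ. Qed.

Lemma cptD u v : cpt u -> cpt v -> cpt (u + v).
Proof.
move=> cu cv n; rewrite [_ - _](_ : _ = (u n.+1 - u n) + (v n.+1 - v n)).
  exact: dvmD.
by rewrite [LHS]/GRing.add /= addrACA -opprD.
Qed.

Lemma cptZ a v : cpt v -> cpt (a *: v).
Proof.
move=> cv n; rewrite [_ - _](_ : _ = a *: (v n.+1 - v n)); first exact: dvmZ.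
by rewrite scalerBr.
Qed.

Lemma cpt_cst k : cpt (cst k).
Proof. by move=> n; rewrite subrr; exact: dvm0. Qed.

Lemma cptB u v : cpt u -> cpt v -> cpt (u - v).
Proof. by move=> cu cv; rewrite -scaleN1r; apply: cptD => //; exact: cptZ. Qed.

End Convergence.

Lemma qS n : q n.+1 = q n * s n.+1.
Proof. by rewrite /Defs.q big_ord_recr. Qed.

Lemma q_dvd m n : (m <= n)%N -> exists r, q n = q m * r.
Proof.
elim: n => [|n IH]; first by rewrite leqn0 => /eqP->; exists 1; rewrite mulr1.
rewrite leq_eqVlt => /predU1P[->|]; first by exists 1; rewrite mulr1.
by rewrite ltnS => /IH[r E]; exists (r * s n.+1); rewrite qS E mulrA.
Qed.

Lemma s_dvd_q m n : (m <= n)%N -> exists r, q n = s m * r.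
Proof.
move=> /q_dvd[r ->]; case: m => [|m].
  by exists r; rewrite /Defs.q big_ord_recr big_ord0 /= mul1r.
by exists (q m * r); rewrite qS; ring.
Qed.

Lemma cpt_smul (V : lmodType R) (x : nat -> R) (v : nat -> V) :
  compat s x -> cpt v -> cpt (smul x v).
Proof.
move=> cx cv n; have [r xr] := cx n.
rewrite [_ - _](_ : _ = (x n.+1 - x n) *: v n.+1 + x n *: (v n.+1 - v n)).
  by apply: dvmD; [rewrite xr -scalerA; exact: dvm_scale|exact: dvmZ].
by rewrite scalerBl scalerBr addrA subrK.
Qed.

Lemma cpt_le (V : lmodType R) (v : nat -> V) m n :
  cpt v -> (m <= n)%N -> dvm (q m) (v n - v m).
Proof.
move=> cv; elim: n => [|n IH].
  by rewrite leqn0 => /eqP->; rewrite subrr; exact: dvm0.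
rewrite leq_eqVlt => /predU1P[->|]; first by rewrite subrr; exact: dvm0.
rewrite ltnS => mn; rewrite -(subrKA (v n)).
apply: dvmD; last exact: IH.
by have [r qr] := q_dvd mn; have := cv n; rewrite qr => /dvm_mulr.
Qed.

Lemma cpt_dvm_le (V : lmodType R) (v : nat -> V) m n :
  cpt v -> (m <= n)%N -> dvm (q m) (v n) -> dvm (q m) (v m).
Proof.
by move=> cv mn vn; rewrite -[v m](subKr (v n)); apply: dvmB => //; exact: cpt_le.
Qed.

Hypothesis HS : mult_closed s.

Lemma s_mul i j : exists k, s k = s i * s j.
Proof. by case: HS => _; apply. Qed.

Lemma q_in_s n : exists k, s k = q n.
Proof.
elim: n => [|n [k IH]].
  by exists 0%N; rewrite /Defs.q big_ord_recr big_ord0 /= mul1r.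
by rewrite qS -IH; exact: s_mul.
Qed.

(** The product [s m * q n] is itself some [s j], which is a factor of [q L] as soon as [j <= L].
    Divisibility lost on dividing by [s m] is thus recovered by going further out. *)
Lemma q_cofinal m n : exists N, (n <= N)%N /\ forall L, (N <= L)%N ->
  exists r, q L = s m * q n * r.
Proof.
have [k Ek] := q_in_s n; have [j Ej] := s_mul m k.
exists (maxn n j); split=> [|L]; first exact: leq_maxl.
rewrite geq_max => /andP[_ jL]; have [r ->] := s_dvd_q jL.
by exists r; rewrite Ej Ek.
Qed.

Section TorsionFree.
Variable V : lmodType R.
Hypothesis tfV : S_torsion_free s V.

Lemma s_cancel m (u v : V) : s m *: u = s m *: v -> u = v.
Proof. by move=> /eqP; rewrite -subr_eq0 -scalerBr => /eqP/tfV/subr0_eq. Qed.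

Lemma dvm_cancel m b (v : V) : dvm (s m * b) (s m *: v) -> dvm b v.
Proof. by move=> [u]; rewrite -scalerA => /s_cancel->; exists u. Qed.

(** Torsion-freeness of the completion: [s m] is cancelled at a late index, and compatibility
    carries the result back to [n]. *)
Lemma nul_tf m (v : nat -> V) : cpt v -> nul (s m *: v) -> nul v.
Proof.
move=> cv nv n; have [N [nN /(_ N (leqnn _))[r qr]]] := q_cofinal m n.
apply: cpt_dvm_le cv nN _; have := nv N; rewrite qr => /dvm_mulr.
exact: dvm_cancel.
Qed.

(** By compatibility all terms from index [m] on are divisible by [q m]. The quotients are taken at
    indices [phi n] so late that congruences modulo [q n] survive the division. *)
Lemma seq_divide m (v : nat -> V) : cpt v -> dvm (q m) (v m) ->
  exists2 z, cpt z & nul (v - q m *: z).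
Proof.
move=> cv vm; have [k qk] := q_in_s m.
have /choice[phi phiP] : forall n, exists N, (maxn m n <= N)%N /\
    forall L, (N <= L)%N -> exists r, q L = q m * q n * r.
  move=> n; have [N [nN NP]] := q_cofinal k n.
  exists (maxn m N); split; first by rewrite geq_max leq_maxl leq_max nN orbT.
  by move=> L; rewrite geq_max -qk => /andP[_ /NP].
have /choice[z zP] : forall n, exists z, v (phi n) = q m *: z.
  move=> n; have [] := phiP n; rewrite geq_max => /andP[mN _] _.
  by rewrite -[v _](subrK (v m)); apply: dvmD => //; exact: cpt_le.
exists z => n.
  apply: (@dvm_cancel k); rewrite qk scalerBr -!zP.
  have [_ P1] := phiP n; have [_ P2] := phiP n.+1.
  (* [phi] need not be monotone, so both orders are treated. *)
  have [le|/ltnW le] := leqP (phi n) (phi n.+1).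
    have [r qr] := P1 _ (leqnn _).
    by have := cpt_le cv le; rewrite qr => /dvm_mulr.
  rewrite -opprB; apply: dvmN.
  have [r qr] := P2 _ (leqnn _).
  have := cpt_le cv le; rewrite qr qS.
  have -> : q m * (q n * s n.+1) * r = q m * q n * (s n.+1 * r) by ring.
  exact: dvm_mulr.
rewrite [(_ - _) n](_ : _ = v n - v (phi n)); last by rewrite zP.
have [+ _] := phiP n; rewrite geq_max => /andP[_ nN].
by rewrite -opprB; apply: dvmN; exact: cpt_le.
Qed.

End TorsionFree.

(* [q m] divides [qprod k / qprod n] when [n < k] and [m <= k], so two branches that
   first differ at [n >= m] differ by [qprod n] times an element that is [1] or [-1]
   modulo [q m]. *)
Definition qprod k : R := \prod_(i < k.+1) q i.

Lemma qprodS k : qprod k.+1 = qprod k * q k.+1.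
Proof. by rewrite /qprod big_ord_recr. Qed.

Lemma qprod_in_s n : exists k, s k = qprod n.
Proof.
elim: n => [|n [k IH]].
  by rewrite /qprod big_ord_recr big_ord0 /= mul1r; exact: q_in_s.
by rewrite qprodS -IH; have [j <-] := q_in_s n.+1; exact: s_mul.
Qed.

Lemma qprod_q k : exists r, qprod k = q k * r.
Proof.
case: k => [|k]; last by exists (qprod k); rewrite qprodS mulrC.
by exists 1; rewrite /qprod big_ord_recr big_ord0 /= mulrC.
Qed.

Lemma qprod_dvd m n k : (m <= k)%N -> (n < k)%N -> exists r, qprod k = qprod n * (q m * r).
Proof.
elim: k => [|k IH] // mk; rewrite ltnS leq_eqVlt => /predU1P[->|nk].
  by have [r qr] := q_dvd mk; exists r; rewrite qprodS qr.
move: mk; rewrite leq_eqVlt => /predU1P[->|mk].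
  have [d E] : exists d, qprod k = qprod n * d.
    elim: {IH} k nk => [|k IH] //; rewrite ltnS leq_eqVlt => /predU1P[->|/IH[d E]].
      by exists (q k.+1); rewrite qprodS.
    by exists (d * q k.+1); rewrite qprodS E mulrA.
  by exists d; rewrite qprodS E; ring.
by have [r E] := IH mk nk; exists (r * q k.+1); rewrite qprodS E; ring.
Qed.

Definition branch (eta : nat -> bool) (n : nat) : R :=
  \sum_(k < n) (eta k)%:R * qprod k.

Lemma branch_compat eta : compat s (branch eta).
Proof.
move=> n; have [r tr] := qprod_q n; exists ((eta n)%:R * r).
by rewrite /branch big_ord_recr /= addrAC subrr add0r tr; ring.
Qed.

Lemma branch_sub m eta eta' : eta <> eta' ->
  (forall k, (k < m)%N -> eta k = eta' k) ->
  exists i e N, e * e = 1 /\ forall L, (N <= L)%N ->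
    exists r, branch eta L - branch eta' L = s i * (e + q m * r).
Proof.
move=> neq agree.
have exn : exists n, eta n != eta' n.
  apply: contrapT => nex; apply: neq; apply/funext => n.
  by apply/eqP/negbNE/negP => ne; apply: nex; exists n.
case: (ex_minnP exn) => n ne nmin.
have [i Ei] := qprod_in_s n.
(* At the first difference [n], the factor [s i] is [qprod n], and [e] is the difference of two
   distinct bits, so it squares to [1]. *)
exists i, ((eta n)%:R - (eta' n)%:R), n.+1; split.
  by move: ne; case: (eta n); case: (eta' n) => // _; rewrite ?subr0 ?sub0r ?mulrNN mulr1.
have mn : (m <= n)%N.
  by rewrite leqNgt; apply/negP => /agree E; move: ne; rewrite E eqxx.
elim=> [//|L IH]; rewrite ltnS leq_eqVlt => /predU1P[<-|nL].
  exists 0; rewrite /branch !big_ord_recr /= mulr0 addr0 Ei.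
  have -> : \sum_(k < n) (eta k)%:R * qprod k = \sum_(k < n) (eta' k)%:R * qprod k.
    apply: eq_bigr => k _; congr (_%:R * _); congr nat_of_bool.
    apply/eqP/negbNE/negP => /nmin; rewrite leqNgt.
    by rewrite ltn_ord.
  by ring.
have [r E] := IH nL; have [d tE] := qprod_dvd (leq_trans mn (ltnW nL)) nL.
exists (r + ((eta L)%:R - (eta' L)%:R) * d).
rewrite /branch !big_ord_recr /= opprD addrACA.
rewrite [_ - _]E tE Ei; ring.
Qed.

End Sequences.

(** * Generic elements of the completion *)

Section Generic.
Variables (R : comNzRingType) (s : nat -> R) (HS : mult_closed s).
Local Notation q := (q s).
Local Notation w := (branch s).
Variables (V : lmodType R) (tfV : S_torsion_free s V).
Implicit Types (a b c v : nat -> V) (eta : nat -> bool).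

(** This is the shape of a difference of two branches agreeing below [m]. It is stable under
    products, and such factors can be cancelled modulo [q m]. *)
Definition almost_s m (x : nat -> R) := exists i e N, e * e = 1 /\
  forall L, (N <= L)%N -> exists r, x L = s i * (e + q m * r).

Lemma almost_s_mul m x y : almost_s m x -> almost_s m y ->
  almost_s m (fun n => x n * y n).
Proof.
move=> [i [e [N [e1 xP]]]] [j [d [M [d1 yP]]]].
have [k Ek] := s_mul HS i j; exists k, (e * d), (maxn N M).
split; first by rewrite mulrACA e1 d1 mulr1.
move=> L; rewrite geq_max => /andP[/xP[r ->] /yP[t ->]].
by exists (e * t + r * d + r * q m * t); rewrite Ek; ring.
Qed.

(** At a late index [s i] cancels by torsion-freeness, and [e + q m * r] is invertible modulo [q m]
    because [e] is its own inverse. *)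
Lemma almost_s_nul m x v : almost_s m x -> cpt s v -> nul s (smul x v) ->
  dvm (q m) (v m).
Proof.
move=> [i [e [N [e1 xP]]]] cv nv.
have [M [mM MP]] := q_cofinal HS i m; pose L := maxn N M.
have [r qr] := MP L (leq_maxr _ _); have [d xd] := xP L (leq_maxl _ _).
have := nv L; rewrite /smul xd qr -scalerA => /dvm_mulr/(dvm_cancel tfV).
rewrite scalerDl -scalerA => /dvmB/(_ (dvm_scale (q m) (d *: v L))); rewrite addrK.
move=> /(dvmZ e); rewrite scalerA e1 scale1r.
by apply: cpt_dvm_le => //; exact: leq_trans mM (leq_maxr _ _).
Qed.

Definition quad a b c (x : nat -> R) : nat -> V :=
  fun n => (x n * x n) *: a n + x n *: b n + c n.

Lemma three_roots m a b c e1 e2 e3 : cpt s a ->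
  e1 <> e2 -> e2 <> e3 -> e3 <> e1 ->
  (forall k, (k < m)%N -> e1 k = e2 k) ->
  (forall k, (k < m)%N -> e2 k = e3 k) ->
  (forall k, (k < m)%N -> e3 k = e1 k) ->
  nul s (quad a b c (w e1)) -> nul s (quad a b c (w e2)) ->
  nul s (quad a b c (w e3)) -> dvm (q m) (a m).
Proof.
move=> ca n12 n23 n31 a12 a23 a31 r1 r2 r3.
have := almost_s_mul (almost_s_mul (branch_sub HS n12 a12) (branch_sub HS n23 a23))
  (branch_sub HS n31 a31).
move=> /almost_s_nul; apply=> // n.
(* Vandermonde determinant *)
rewrite [smul _ _ _](_ : _ = - ((w e2 n - w e3 n) *: quad a b c (w e1) n
   + (w e3 n - w e1 n) *: quad a b c (w e2) n
   + (w e1 n - w e2 n) *: quad a b c (w e3) n)).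
  by apply: dvmN; do 2?apply: dvmD; apply: dvmZ; [exact: r1|exact: r2|exact: r3].
rewrite /smul /quad.
move: (w e1 n) (w e2 n) (w e3 n) (a n) (b n) (c n) => x y z A B C.
have E (d x1 : R) : d *: (x1 * x1 *: A + x1 *: B + C) =
    (d * (x1 * x1)) *: A + (d * x1) *: B + d *: C by rewrite !scalerDr !scalerA.
have D (f1 f2 f3 g1 g2 g3 : R) : f1 *: A + f2 *: B + f3 *: C +
    (g1 *: A + g2 *: B + g3 *: C) =
    (f1 + g1) *: A + (f2 + g2) *: B + (f3 + g3) *: C.
  by rewrite !scalerDl addrACA (addrACA (f1 *: A)).
rewrite !E !D.
have -> : y - z + (z - x) + (x - y) = 0 by ring.
have -> : (y - z) * x + (z - x) * y + (x - y) * z = 0 by ring.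
by rewrite !scale0r !addr0 -scaleNr; congr (_ *: _); ring.
Qed.

Lemma two_roots m b c e1 e2 : cpt s b -> e1 <> e2 ->
  (forall k, (k < m)%N -> e1 k = e2 k) ->
  nul s (smul (w e1) b + c) -> nul s (smul (w e2) b + c) -> dvm (q m) (b m).
Proof.
move=> cb n12 a12 r1 r2; apply: almost_s_nul (branch_sub HS n12 a12) cb _ => n.
rewrite /smul scalerBl.
rewrite [_ - _](_ : _ = (smul (w e1) b + c) n - (smul (w e2) b + c) n).
  by apply: dvmB.
have E x : (smul x b + c) n = x n *: b n + c n by [].
by rewrite !E [in RHS]opprD addrACA subrr addr0.
Qed.

(** The index [m] witnesses that [a] is not null or, when [a] is null, that [b] is not; the root
    bound of degree two or one contradicts this. *)
Lemma few_roots a b c : cpt s a -> cpt s b -> ~ (nul s a /\ nul s b) ->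
  exists m, forall e1 e2 e3, e1 <> e2 -> e2 <> e3 -> e3 <> e1 ->
  (forall k, (k < m)%N -> e1 k = e2 k) ->
  (forall k, (k < m)%N -> e2 k = e3 k) ->
  nul s (quad a b c (w e1)) -> nul s (quad a b c (w e2)) ->
  nul s (quad a b c (w e3)) -> False.
Proof.
move=> ca cb nab.
have [na|/existsNP[m am]] := pselect (nul s a); last first.
  exists m => e1 e2 e3 n12 n23 n31 a12 a23 r1 r2 r3; apply: am.
  apply: (three_roots ca n12 n23 n31 a12 a23 _ r1 r2 r3) => k km.
  by rewrite -a23 // a12.
have [nb|/existsNP[m bm]] := pselect (nul s b); first by case: nab.
exists m => e1 e2 e3 n12 _ _ a12 _ r1 r2 _; apply: bm.
have root e : nul s (quad a b c (w e)) -> nul s (smul (w e) b + c).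
  move=> r n; have E : (smul (w e) b + c) n = w e n *: b n + c n by [].
  rewrite E -[w e n *: b n](addKr ((w e n * w e n) *: a n)) -addrA.
  by apply: dvmD; [apply: dvmN; exact: dvmZ|exact: r].
exact: two_roots cb n12 a12 (root _ r1) (root _ r2).
Qed.

(* The branches that are roots of a given nontrivial polynomial form a set with
   at most two elements in each of finitely many cylinders, so fewer than 2^aleph0
   polynomials cannot exhaust all branches. *)
Lemma generic_branch (X I : Type) (a b c : I -> nat -> V) :
  card_le nat X -> ~ card_le (nat -> bool) X -> card_le I X ->
  (forall i, cpt s (a i)) -> (forall i, cpt s (b i)) ->
  exists eta, forall i, nul s (quad (a i) (b i) (c i) (w eta)) ->
    nul s (a i) /\ nul s (b i).
Proof.
move=> natX smallX IX ca cb; apply: contrapT => nex; apply: smallX.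
have /choice[ix ixP] : forall eta, exists i,
    nul s (quad (a i) (b i) (c i) (w eta)) /\ ~ (nul s (a i) /\ nul s (b i)).
  move=> eta; have /forallNP/(_ eta)/existsNP[i /not_implyP] := nex.
  by exists i.
have /choice[m mP] : forall i, exists m, ~ (nul s (a i) /\ nul s (b i)) ->
   forall e1 e2 e3, e1 <> e2 -> e2 <> e3 -> e3 <> e1 ->
  (forall k, (k < m)%N -> e1 k = e2 k) ->
  (forall k, (k < m)%N -> e2 k = e3 k) ->
  nul s (quad (a i) (b i) (c i) (w e1)) -> nul s (quad (a i) (b i) (c i) (w e2)) ->
  nul s (quad (a i) (b i) (c i) (w e3)) -> False.
  move=> i; have [nab|nab] := pselect (nul s (a i) /\ nul s (b i)); first by exists 0%N.
  by have [m mP] := few_roots (c i) (ca i) (cb i) nab; exists m.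
pose F (eta : nat -> bool) := (ix eta, mkseq eta (m (ix eta))).
have FP e1 e2 : F e1 = F e2 -> ix e1 = ix e2 /\ forall k, (k < m (ix e1))%N -> e1 k = e2 k.
  move=> [E]; rewrite -E => S; split=> // k km.
  by rewrite -(nth_mkseq false e1 km) S nth_mkseq.
(* [rho] picks a point in each nonempty fibre of [F]. A fibre has at most two points, so [F eta] and
   the truth value of [eta = rho (F eta)] determine [eta]. *)
have /choice[rho rhoP] : forall y, exists rho, forall eta, F eta = y -> F rho = y.
  move=> y; have [[eta <-]|ny] := pselect (exists eta, F eta = y); first by exists eta.
  by exists (fun=> true) => eta /(fun E => ny (ex_intro _ _ E)).
apply: (@card_le_trans (I * seq bool * bool)); last first.
  do 2?apply: card_le_prodX => //; last exact: card_le_nat_bool.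
  by apply: card_le_seqX => //; exact: card_le_nat_bool.
exists (fun eta => (F eta, `[< eta = rho (F eta) >])) => e1 e2 [ixE mkE E].
have FE : F e1 = F e2 by congr (_, _).
have {}E : (e1 = rho (F e1)) <-> (e2 = rho (F e1)).
  rewrite {2}FE; split=> H; apply/asboolP; [rewrite -E|rewrite E]; exact/asboolP.
apply: contrapT => n12.
have n1 : e1 <> rho (F e1) by move=> H; apply: n12; rewrite H; apply/esym/E.
have n2 : e2 <> rho (F e1) by move=> H; apply: n12; rewrite H; apply/E.
have Frho := rhoP _ e1 erefl.
have [r1 nab] := ixP e1; have [r2 _] := ixP e2; have [r3 _] := ixP (rho (F e1)).
have [ix13 a13] := FP _ _ Frho; have [ix12 a12] := FP _ _ FE.
apply: (mP _ nab e1 (rho (F e1)) e2) => //; try exact: nesym.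
- by move=> k km; rewrite a13 // ix13.
- by move=> k km; rewrite a13 ?ix13 // a12.
- by rewrite -ix13.
- by rewrite ix12.
Qed.

End Generic.

(** * Linear combinations and independence modulo null sequences *)

Section Combinations.
Variables (R : comNzRingType) (O : Type).
Implicit Types (l : seq (R * O)).

(** Indices may repeat in [l], so that adding and scaling combinations are concatenation and
    [scale_comb], and combinations can be counted as lists. *)
Definition comb (M : lmodType R) (e : O -> M) l := \sum_(p <- l) p.1 *: e p.2.

Definition scale_comb (a : R) l := [seq (a * p.1, p.2) | p <- l].

Lemma comb_nil (M : lmodType R) (e : O -> M) : comb e [::] = 0.
Proof. exact: big_nil. Qed.

Lemma comb_cons (M : lmodType R) (e : O -> M) c o l :
  comb e ((c, o) :: l) = c *: e o + comb e l.
Proof. exact: big_cons. Qed.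

Lemma comb_cat (M : lmodType R) (e : O -> M) l l' :
  comb e (l ++ l') = comb e l + comb e l'.
Proof. exact: big_cat. Qed.

Lemma combZ (M : lmodType R) (e : O -> M) a l :
  comb e (scale_comb a l) = a *: comb e l.
Proof.
by rewrite /comb big_map scaler_sumr; apply: eq_bigr => p _; rewrite scalerA.
Qed.

Lemma comb1 (M : lmodType R) (e : O -> M) c o : comb e [:: (c, o)] = c *: e o.
Proof. by rewrite comb_cons comb_nil addr0. Qed.

Lemma comb_sum (M : lmodType R) (e : O -> M) (c : O -> R) (r : seq O) :
  \sum_(o <- r) c o *: e o = comb e [seq (c o, o) | o <- r].
Proof. by rewrite /comb big_map. Qed.

End Combinations.

(** Collecting repeated indices gives access to the duplicate-free lists in [lin_indep] and
    [nul_indep]. *)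
Lemma comb_regroup (R : comNzRingType) (O : eqType) (M : lmodType R)
  (e : O -> M) (l : seq (R * O)) :
  comb e l = \sum_(o <- undup [seq p.2 | p <- l])
    (\sum_(p <- l | p.2 == o) p.1) *: e o.
Proof.
under [RHS]eq_bigr do rewrite scaler_suml.
rewrite (exchange_big_dep predT) //= /comb big_seq [RHS]big_seq.
apply: eq_bigr => p pl.
rewrite -big_filter (eq_filter (a2 := pred1 p.2)) => [|o]; last exact: eq_sym.
by rewrite filter_pred1_uniq ?undup_uniq ?mem_undup ?map_f // big_seq1.
Qed.

Section NullIndependence.
Variables (R : comNzRingType) (s : nat -> R).

(** For compatible [w] this is linear independence over [R] in the completion of [R]. *)
Definition nul_indep (O : eqType) (w : O -> nat -> R^o) :=
  forall (l : seq O) (c : O -> R), uniq l ->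
    nul s (\sum_(o <- l) c o *: w o) -> forall o, o \in l -> c o = 0.

Lemma nul_indep_comb (O : eqType) (w : O -> nat -> R^o) (M : lmodType R)
  (e : O -> M) l : nul_indep w -> nul s (comb w l) -> comb e l = 0.
Proof.
move=> wI; rewrite comb_regroup => /(wI _ _ (undup_uniq _)) c0.
by rewrite comb_regroup big_seq big1 // => o /c0->; rewrite scale0r.
Qed.

Lemma cpt_comb (O : Type) (M : lmodType R) (w : O -> nat -> M) l :
  (forall o, cpt s (w o)) -> cpt s (comb w l).
Proof.
move=> cw; elim: l => [|[c o] l IH]; first by rewrite comb_nil; exact: cpt_cst.
by rewrite comb_cons; apply: cptD => //; exact: cptZ.
Qed.

Hypothesis (HS : mult_closed s) (tfR : S_torsion_free s R^o) (redR : S_reduced s R^o).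

(** A reduced module embeds in its completion, since [s n] divides [q n]. *)
Lemma nul_cst (V : lmodType R) (k : V) : S_reduced s V -> nul s (cst k) -> k = 0.
Proof.
move=> redV nk; apply: redV => n; have [r qr] := s_dvd_q s (leqnn n).
by have := nk n; rewrite qr => /dvm_mulr[u E]; exists u.
Qed.

Definition with_one (J : Type) (b : J -> nat -> bool) (o : option J) : nat -> R^o :=
  if o is Some j then branch s (b j) else cst (1 : R^o).

Lemma cpt_with_one J (b : J -> nat -> bool) o : cpt s (with_one b o).
Proof. by case: o => [j|]; [exact: branch_compat|exact: cpt_cst]. Qed.

(** Genericity is applied to polynomials of degree at most one with leading coefficient [beta] in
    [R] and constant term a combination of [1] and branches in [W]; these polynomials can be indexed
    by a type embedding in [X]. *)
Lemma with_one_extend (X : Type) (W : set (nat -> bool)) :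
  card_le nat X -> ~ card_le (nat -> bool) X -> card_le R X ->
  card_le {eta | W eta} X ->
  exists eta, forall beta (l : seq (R * option (nat -> bool))),
    (forall p, p \in l -> if p.2 is Some eta' then W eta' else True) ->
    nul s (beta *: (branch s eta : nat -> R^o) + comb (with_one id) l) -> beta = 0.
Proof.
move=> natX smallX RX WX.
have IX : card_le (R * seq (R * option {eta | W eta})) X.
  apply: card_le_prodX => //; apply: card_le_seqX => //.
  by apply: card_le_prodX => //; exact: card_le_optionX.
have [eta etaP] := generic_branch HS tfR (a := fun=> cst 0)
  (b := fun i => cst (i.1 : R^o)) (fun i => comb (with_one sval) i.2) natX smallX IX
  (fun=> cpt_cst _ _) (fun=> cpt_cst _ _).
exists eta => beta l lW nl.
have [l' El] : exists l' : seq (R * option {eta | W eta}),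
    comb (with_one sval) l' = comb (with_one id) l.
  elim: l lW {nl} => [|[c o] l IH] lW; first by exists [::]; rewrite !comb_nil.
  have [|l' El] := IH; first by move=> p pl; apply: lW; rewrite inE pl orbT.
  have := lW (c, o); rewrite inE eqxx => /(_ isT) /=.
  case: o {lW} => [eta'|] Weta.
    by exists ((c, Some (exist _ _ Weta)) :: l'); rewrite !comb_cons El.
  by exists ((c, None) :: l'); rewrite !comb_cons El.
have [|_ nb] := etaP (beta, l'); last exact: (nul_cst redR nb).
move=> n; rewrite /quad El scaler0 add0r; have := nl n.
by congr dvm; congr (_ + _); rewrite /cst /= [RHS]mulrC.
Qed.

Definition branches_in (W : set (nat -> bool)) (l : seq (option (nat -> bool))) :=
  forall eta, Some eta \in l -> W eta.

Definition indep_branches (W : set (nat -> bool)) :=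
  forall (l : seq (option (nat -> bool))) c, uniq l -> branches_in W l ->
    nul s (\sum_(o <- l) c o *: with_one id o) -> forall o, o \in l -> c o = 0.

Lemma indep_branches0 : indep_branches set0.
Proof.
move=> l c ul lW; have lN o : o \in l -> o = None by case: o => // eta /lW.
move=> nl o ol; have oN := lN _ ol; subst o.
move: nl; rewrite (perm_big _ (perm_to_rem ol)) big_cons /=.
have -> : rem None l = [::].
  case E: (rem None l) => [//|o r]; have : o \in rem None l by rewrite E mem_head.
  by rewrite mem_rem_uniq // inE => /andP[/eqP ne /lN].
rewrite big_nil addr0 => nc; apply: (nul_cst redR) => n.
by have [u E] := nc n; exists u; rewrite -E; exact/esym/mulr1.
Qed.

Lemma indep_branches_maximal : exists W, indep_branches W /\
  forall W', (W `<` W')%classic -> ~ indep_branches W'.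
Proof.
apply: Zorn_bigcup => F FP Ftot l c ul lU nl.
suff [Z [ZP lZ]] : exists Z, indep_branches Z /\ branches_in Z l.
  exact: ZP ul lZ nl.
(* A finite list involves only one member of the chain; the alternative [set0] covers the empty
   chain and lists without branches. *)
suff [Z [[Z0|FZ] lZ]] : exists Z, (Z = set0 \/ F Z) /\ branches_in Z l.
- by exists set0; split; [exact: indep_branches0|rewrite -Z0].
- by exists Z; split=> //; exact: FP.
elim: l lU {ul nl} => [|o l IH] lU; first by exists set0; split=> //; left.
have [|Z [FZ lZ]] := IH.
  by move=> eta el; apply: lU; rewrite inE el orbT.
case: o lU => [eta|] lU; last first.
  by exists Z; split=> // eta; rewrite inE => /lZ.
have [|Y FY Yeta] := lU eta; first by rewrite inE eqxx.
case: FZ => [Z0|FZ].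
  exists Y; split; first by right.
  by move=> eta'; rewrite inE => /predU1P[[->]//|/lZ]; rewrite Z0.
have [YZ|ZY] := Ftot _ _ FY FZ; [exists Z|exists Y]; (split; first by right).
  by move=> eta'; rewrite inE => /predU1P[[->]|/lZ//]; exact: YZ.
by move=> eta'; rewrite inE => /predU1P[[->]//|/lZ/ZY].
Qed.

(** If instead [W] embedded in [X], some branch would be generic over [W]. It lies outside [W], as
    the relation [eta - eta = 0] shows, and adding it would contradict maximality. *)
Lemma indep_branches_large X W : card_le nat X -> ~ card_le (nat -> bool) X ->
  card_le R X -> indep_branches W ->
  (forall W', (W `<` W')%classic -> ~ indep_branches W') ->
  card_le X {eta | W eta}.
Proof.
move=> natX smallX RX WI Wmax.
have [//|WX] := card_le_total X {eta | W eta}; exfalso.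
have [eta etaP] := with_one_extend natX smallX RX WX.
apply: (Wmax (W `|` [set eta])%classic).
  split; first by move=> x Wx; left.
  move=> sub; have Weta : W eta by apply: sub; right.
  have /eqP := oner_neq0 R; apply; apply: (etaP 1 [:: (-1, Some eta)]).
    by move=> p; rewrite inE => /eqP->.
  by rewrite comb1 /= scale1r scaleN1r subrr => n; exact: dvm0.
move=> l c ul lW.
have rest l' : {subset l' <= l} -> Some eta \notin l' -> branches_in W l'.
  move=> sub nin e el'; have [//|/= E] := lW _ (sub _ el').
  by move: nin; rewrite -E el'.
have [el|nel] := boolP (Some eta \in l); last exact: WI (rest _ _ nel).
have remW : branches_in W (rem (Some eta) l).
  by apply: rest => [e|]; [exact: mem_rem|rewrite mem_rem_uniq // inE eqxx].
rewrite (perm_big _ (perm_to_rem el)) big_cons /= => nl.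
have c0 : c (Some eta) = 0.
  apply: (etaP _ [seq (c o, o) | o <- rem (Some eta) l]); last by rewrite -comb_sum.
  by move=> _ /mapP[[e|] oe ->] //=; exact: remW.
move: nl; rewrite c0 scale0r add0r => nl o ol.
have [->//|ne] := eqVneq o (Some eta).
by apply: WI (nl) _ _; rewrite ?rem_uniq // mem_rem_uniq // inE ne.
Qed.

Lemma indep_family (X : Type) (J : eqType) : card_le nat X ->
  ~ card_le (nat -> bool) X -> card_le R X -> card_le J X ->
  exists b : J -> nat -> bool, nul_indep (with_one b).
Proof.
move=> natX smallX RX JX; have [W [WI Wmax]] := indep_branches_maximal.
have [f fI] := card_le_trans JX (indep_branches_large natX smallX RX WI Wmax).
pose b j := sval (f j).
have bI : injective (omap b).
  by move=> [i|] [j|] //= [] E; congr Some; apply: fI; move: E;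
    rewrite /b; case: (f i) (f j) => x Wx [y Wy] /= E; exact: eq_exist.
have [g gK] : exists g, cancel (omap b) g.
  have /choice[g gP] : forall e, exists o, forall o', omap b o' = e -> o' = o.
    move=> e; have [[o <-]|ne] := pselect (exists o, omap b o = e).
      by exists o => o' /bI.
    by exists None => o' /(fun E => ne (ex_intro _ _ E)).
  by exists g => o; rewrite -(gP _ o).
exists b => l c ul nl o ol; rewrite -[o]gK.
apply: (WI (map (omap b) l) (c \o g)) => /=.
- by rewrite map_inj_uniq.
- by move=> eta /mapP[[j|] // _ [->]]; exact: svalP.
- rewrite big_map; move: nl; congr (nul _ _); apply: eq_bigr => o' _.
  by rewrite gK; case: o'.
- exact: map_f.
Qed.

End NullIndependence.

(** * Simultaneous genericity over [K] and [R] *)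

Section Pairs.
Variables (R : comNzRingType) (s : nat -> R) (U V : lmodType R).

Lemma S_torsion_free_pair : S_torsion_free s U -> S_torsion_free s V ->
  S_torsion_free s (U * V)%type.
Proof. by move=> tU tV n [u v] [/tU-> /tV->]. Qed.

Definition pair_seq (u : nat -> U) (v : nat -> V) : nat -> (U * V)%type :=
  fun n => (u n, v n).

Lemma dvm_pair a (x : U * V) : dvm a x <-> dvm a x.1 /\ dvm a x.2.
Proof.
split=> [[y ->]|[[u E] [v F]]]; first by split; [exists y.1|exists y.2].
by exists (u, v); case: x E F => x y /= -> ->.
Qed.

Lemma nul_pair u v : nul s (pair_seq u v) <-> nul s u /\ nul s v.
Proof.
split=> [nuv|[nu nv] n]; last exact/dvm_pair.
by split=> n; have /dvm_pair[] := nuv n.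
Qed.

Lemma cpt_pair u v : cpt s (pair_seq u v) <-> cpt s u /\ cpt s v.
Proof.
split=> [cuv|[cu cv] n]; last exact/dvm_pair.
by split=> n; have /dvm_pair[] := cuv n.
Qed.

End Pairs.

Section GenericFamily.
Variables (R : comNzRingType) (s : nat -> R) (K : lmodType R) (J : eqType) (j0 : J).

(** [gf_quad] and [gf_K] express the genericity of [w (Some j0)], and [gf_quad'] and [gf_K'] that of
    [w']. In [gf_quad] the combination over [l] may contain [w (Some j0)] itself, which makes the
    equation quadratic. *)
Record generic_family (w : option J -> nat -> R^o) (w' : nat -> R^o) : Prop :=
 GenericFamily {
  gf_one : w None = cst (1 : R^o);
  gf_cpt : forall o, cpt s (w o);
  gf_cpt' : cpt s w';
  gf_indep : nul_indep s w;
  gf_quad : forall l l', nul s (smul (w (Some j0)) (comb w l) - comb w l') ->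
    exists c : R^o, nul s (comb w l - cst c);
  gf_K : forall k0 k1 : K, nul s (smul (w (Some j0)) (cst k0) - cst k1) -> k0 = 0;
  gf_quad' : forall l0 l1 l2, nul s (smul (w (Some j0)) (comb w l0) +
      smul w' (comb w l1) - comb w l2) -> nul s (comb w l1);
  gf_K' : forall k0 k1 k2 : K, nul s (smul (w (Some j0)) (cst k0) +
      smul w' (cst k1) - cst k2) -> k1 = 0 }.

Hypotheses (HS : mult_closed s) (tfR : S_torsion_free s R^o) (redR : S_reduced s R^o).
Hypotheses (tfK : S_torsion_free s K) (redK : S_reduced s K).

(** Starting from an independent family [w0], a branch [v] generic over it replaces [w0 (Some j0)];
    then [w'] is chosen generic over the resulting [w]. Coefficients in [K * R^o] make one branch
    generic over [K] and over [R] at once. *)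
Lemma generic_family_exists (X : Type) : card_le nat X ->
  ~ card_le (nat -> bool) X -> card_le R X -> card_le K X -> card_le J X ->
  exists w w', generic_family w w'.
Proof.
move=> natX smallX RX KX JX.
have tfV := S_torsion_free_pair tfK tfR.
have [b bI] := indep_family HS tfR redR natX smallX RX JX.
pose w0 := with_one s b.
have cw0 o : cpt s (w0 o) by exact: cpt_with_one.
have seqX : card_le (seq (R * option J)) X.
  by apply: card_le_seqX => //; apply: card_le_prodX => //; exact: card_le_optionX.
pose I1 := (K * K * (R * seq (R * option J) * seq (R * option J)))%type.
have I1X : card_le I1 X by do ?apply: card_le_prodX => //.
pose a1 (i : I1) := pair_seq (cst (0 : K)) (cst (i.2.1.1 : R^o)).
pose b1 (i : I1) := pair_seq (cst i.1.1) (comb w0 i.2.1.2).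
pose c1 (i : I1) := pair_seq (cst i.1.2) (comb w0 i.2.2).
have ca1 i : cpt s (a1 i) by apply/cpt_pair; split; exact: cpt_cst.
have cb1 i : cpt s (b1 i).
  by apply/cpt_pair; split; [exact: cpt_cst|exact: cpt_comb].
have [eta etaP] := generic_branch HS tfV c1 natX smallX I1X ca1 cb1.
pose v : nat -> R^o := branch s eta.
have cv : cpt s v by exact: branch_compat.
have vR alpha l1 l2 : nul s (alpha *: smul v v + smul v (comb w0 l1) + comb w0 l2) ->
    alpha = 0 /\ nul s (comb w0 l1).
  move=> nl; have [] := etaP (0, 0, (alpha, l1, l2)).
    move=> n; apply/dvm_pair; split=> /=; first by rewrite !scaler0 !addr0; exact: dvm0.
    by have := nl n; congr dvm; congr (_ + _ + _); exact: mulrC.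
  by move=> /nul_pair[_ /(nul_cst redR) E] /nul_pair[_ n1]; split; [exact: E|exact: n1].
have vK (k0 k1 : K) : nul s (smul v (cst k0) + cst k1) -> k0 = 0.
  move=> nk; have [] := etaP (k0, k1, (0, [::], [::])).
    move=> n; apply/dvm_pair; split=> /=.
      by rewrite scaler0 add0r; exact: nk.
    by rewrite comb_nil !scaler0 !addr0; exact: dvm0.
  by move=> _ /nul_pair[/(nul_cst redK)].
pose w o := if o == Some j0 then v else w0 o.
have wj : w (Some j0) = v by rewrite /w eqxx.
have cw o : cpt s (w o) by rewrite /w; case: ifP.
have wI : nul_indep s w.
  move=> l c ul nl.
  have eqw0 r : Some j0 \notin r ->
      \sum_(o <- r) c o *: w o = \sum_(o <- r) c o *: w0 o.
    move=> nr; rewrite big_seq [RHS]big_seq; apply: eq_bigr => o or.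
    by rewrite /w; case: eqP => // E; rewrite -E or in nr.
  have [jl|nj] := boolP (Some j0 \in l); last by apply: bI ul _; rewrite -eqw0.
  move: nl; rewrite (perm_big _ (perm_to_rem jl)) big_cons /= wj.
  have nrem : Some j0 \notin rem (Some j0) l by rewrite mem_rem_uniq // inE eqxx.
  rewrite eqw0 // => nl.
  have c0 : c (Some j0) = 0.
    have [] := vR 0 [:: (c (Some j0), None)] [seq (c o, o) | o <- rem (Some j0) l].
      rewrite scale0r add0r comb1 -comb_sum.
      rewrite (_ : smul v _ = c (Some j0) *: v) //; apply/funext => n.
      by rewrite [LHS](_ : _ = v n * (c (Some j0) * 1)) // mulr1 mulrC.
    move=> _; rewrite comb1 => n1; apply: (nul_cst redR) => n.
    by have [u E] := n1 n; exists u; rewrite -E; exact/esym/mulr1.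
  move: nl; rewrite c0 scale0r add0r => nl o ol.
  have [->//|ne] := eqVneq o (Some j0).
  by apply: bI (nl) _ _; rewrite ?rem_uniq // mem_rem_uniq // inE ne.
have wE l : exists l' alpha, comb w l = comb w0 l' + alpha *: v.
  elim: l => [|[c o] l [l' [alpha E]]].
    by exists [::], 0; rewrite !comb_nil scale0r addr0.
  rewrite comb_cons E /w; case: eqP => [_|_].
    by exists l', (c + alpha); rewrite scalerDl addrCA.
  by exists ((c, o) :: l'), alpha; rewrite comb_cons addrA.
pose I2 := (K * K * K * (seq (R * option J) * seq (R * option J) * seq (R * option J)))%type.
have I2X : card_le I2 X by do ?apply: card_le_prodX => //.
pose b2 (i : I2) := pair_seq (cst i.1.1.2) (comb w i.2.1.2).
pose c2 (i : I2) := pair_seq (smul v (cst i.1.1.1) - cst i.1.2)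
   (smul v (comb w i.2.1.1) - comb w i.2.2).
have cb2 i : cpt s (b2 i).
  by apply/cpt_pair; split; [exact: cpt_cst|exact: cpt_comb].
have [eta' etaP'] := generic_branch HS tfV c2 natX smallX I2X (fun=> cpt_cst _ 0) cb2.
exists w, (branch s eta'); split=> //.
- exact: branch_compat.
- move=> l l'; rewrite wj; have [l1 [alpha ->]] := wE l; have [l2 [c ->]] := wE l'.
  move=> nl; exists c.
  (* As a polynomial in [v] the relation has leading coefficient [alpha] and linear coefficient
     [comb w0 l1 - c]. Both vanish, so [comb w l] is the constant [c]. *)
  have [|-> n1] := vR alpha ((- c, None) :: l1) (scale_comb (-1) l2).
    move: nl; congr nul; rewrite comb_cons combZ.
    apply/funext => n; rewrite /smul.
    rewrite [LHS](_ : _ = v n * (comb w0 l1 n + alpha * v n) - (comb w0 l2 n + c * v n)) //.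
    rewrite [RHS](_ : _ = alpha * (v n * v n) + v n * (- c * 1 + comb w0 l1 n) + -1 * comb w0 l2 n) //.
    by move: (comb w0 l1 n) (comb w0 l2 n) (v n) => x y z; rewrite /=; ring.
  move: n1; congr nul; rewrite comb_cons scale0r addr0 addrC; congr (_ + _).
  by apply/funext => n; exact: mulr1.
- by move=> k0 k1; rewrite wj => nk; apply: (vK _ (- k1)); exact: nk.
- move=> l0 l1 l2; rewrite wj => nl.
  have [|_ /nul_pair[]//] := etaP' (0, 0, 0, (l0, l1, l2)).
  move=> n; apply/dvm_pair; split=> /=.
    have -> : (smul v (cst 0) - cst 0) n = (0 : K).
      by rewrite [LHS](_ : _ = v n *: 0 - 0) // scaler0 subrr.
    by rewrite !scaler0 !addr0; exact: dvm0.
  by have := nl n; congr dvm; rewrite scaler0 add0r addrCA addrA.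
- move=> k0 k1 k2; rewrite wj => nk.
  have [|_ /nul_pair[/(nul_cst redK)]//] := etaP' (k0, k1, k2, ([::], [::], [::])).
  move=> n; apply/dvm_pair; split=> /=.
    by have := nk n; congr dvm; rewrite scaler0 add0r addrCA addrA.
  rewrite comb_nil !scaler0 !add0r.
  have -> : (smul v 0 - 0) n = (0 : R^o).
    by rewrite [LHS](_ : _ = v n *: 0 - 0) // scaler0 subrr.
  exact: dvm0.
Qed.

End GenericFamily.

(** * The module G *)

Lemma linear_exists (R : comNzRingType) (U V : lmodType R) (f : U -> V) :
  linear f -> exists g : {linear U -> V}, g =1 f.
Proof.
move=> fL; pose M := GRing.isLinear.Build R U V _ f fL.
by pose g : {linear U -> V} := HB.pack f M; exists g.
Qed.

Section Construction.
Variables (R : comNzRingType) (s : nat -> R) (K : lmodType R) (J : eqType) (j0 : J).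
Hypotheses (HS : mult_closed s) (tfR : S_torsion_free s R^o) (redR : S_reduced s R^o).
Hypotheses (tfK : S_torsion_free s K) (redK : S_reduced s K).
Local Notation q := (q s).
Local Notation V := (K * R^o)%type.
Variables (w : option J -> nat -> R^o) (w' : nat -> R^o).
Hypothesis gf : generic_family s K j0 w w'.
Variable eps : option J -> K.
Hypothesis eps0 : eps None = 0.
Hypothesis eps_span : forall k, exists m l, s m *: k = comb eps l.

Let tfV := S_torsion_free_pair tfK tfR.

(* [gen k l] is [k + \sum c y_o] over the pairs [(c, o)] of [l], where
   [y_o = w_o x + w' eps_o]; as [w None = 1] and [eps None = 0], [x] is [y_None]. *)
Definition gen (k : K) (l : seq (R * option J)) : nat -> V :=
  pair_seq (cst k + smul w' (cst (comb eps l))) (comb w l).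

Lemma gen0 : gen 0 [::] = 0.
Proof.
apply/funext => n; rewrite /gen !comb_nil; congr (_, _).
by rewrite [LHS](_ : _ = 0 + w' n *: 0) // scaler0 addr0.
Qed.

Lemma gen_lin a k k' l l' :
  gen (a *: k + k') (scale_comb a l ++ l') = a *: gen k l + gen k' l'.
Proof.
apply/funext => n; rewrite /gen !comb_cat !combZ.
congr (_, _); rewrite [LHS](_ : _ = a *: k + k' + w' n *: (a *: comb eps l + comb eps l')) //.
rewrite [RHS](_ : _ = a *: (k + w' n *: comb eps l) + (k' + w' n *: comb eps l')) //.
by rewrite !scalerDr !scalerA [w' n * a]mulrC addrACA.
Qed.

Lemma genZ a k l : gen (a *: k) (scale_comb a l) = a *: gen k l.
Proof. by rewrite -[a *: k]addr0 -[scale_comb a l]cats0 gen_lin gen0 addr0. Qed.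

Lemma genE k l n :
  gen k l n = (k, 0) + comb (fun o => (w' n *: eps o, w o n) : V) l.
Proof.
elim: l => [|[c o] l IH].
  rewrite comb_nil addr0 /gen !comb_nil /pair_seq.
  by rewrite [LHS](_ : _ = (k + w' n *: 0, 0)) // scaler0 addr0.
rewrite comb_cons addrCA -IH /gen !comb_cons.
rewrite [LHS](_ : _ = (k + w' n *: (c *: eps o + comb eps l), c *: w o n + comb w l n)) //.
rewrite [RHS](_ : _ = (c *: (w' n *: eps o) + (k + w' n *: comb eps l),
  c *: w o n + comb w l n)) //.
by rewrite scalerDr addrCA !scalerA [c * _]mulrC.
Qed.

Lemma cpt_gen k l : cpt s (gen k l).
Proof.
apply/cpt_pair; split; last exact: cpt_comb (gf_cpt gf).
by apply: cptD; [exact: cpt_cst|apply: cpt_smul; [exact: gf_cpt' gf|exact: cpt_cst]].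
Qed.

(** This is the pure closure, inside the completion of [V], of the submodule of the elements
    [gen k l]. *)
Definition in_hull (v : nat -> V) :=
  cpt s v /\ exists m k l, nul s (s m *: v - gen k l).

Lemma in_hull_gen k l : in_hull (gen k l).
Proof.
have [[m sm] _] := HS; split; first exact: cpt_gen.
by exists m, k, l; rewrite sm scale1r subrr => n; exact: dvm0.
Qed.

Lemma in_hull_submodule : submodule in_hull.
Proof.
split=> [|a u v [cu [m [k [l nu]]]] [cv [m' [k' [l' nv]]]]].
  split; first exact: cpt_cst.
  by exists 0%N, 0, [::]; rewrite scaler0 gen0 subrr => n; exact: dvm0.
split; first by apply: cptD => //; exact: cptZ.
have [i si] := s_mul HS m m'.
exists i, ((a * s m') *: k + s m *: k'), (scale_comb (a * s m') l ++ scale_comb (s m) l').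
rewrite gen_lin genZ (_ : _ - _ = (a * s m') *: (s m *: u - gen k l) +
  s m *: (s m' *: v - gen k' l')); first by apply: nulD; exact: nulZ.
rewrite !scalerBr !scalerDr !scalerA si opprD addrACA; congr (_ *: _ + _ + _).
by ring.
Qed.

(* [rep] picks a representing sequence, so it is linear only modulo null
   sequences. *)
Lemma hull_exists : exists (G : lmodType R) (rep : G -> nat -> V),
  [/\ forall g, in_hull (rep g),
      forall a g h, nul s (rep (a *: g + h) - (a *: rep g + rep h)),
      forall g, nul s (rep g) -> g = 0 &
      forall v, in_hull v -> exists g, nul s (rep g - v)].
Proof.
(* [B] is the module of all sequences modulo null ones; [G] is the image of the hull in it. *)
have [B [cl [clS cl0]]] := quotmod_exists (nul_submodule s V).
have [|G [inc [incI incP]]] := @submod_exists R B (fun x => exists2 v, in_hull v & cl v = x).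
  have [h0 hD] := in_hull_submodule; split; first by exists 0; rewrite ?raddf0.
  move=> a _ _ [u hu <-] [v hv <-]; exists (a *: u + v); first exact: hD.
  by rewrite linearP.
have /choice[rep repP] : forall g, exists v, in_hull v /\ cl v = inc g.
  by move=> g; have [|v hv E] := (incP (inc g)).2; [exists g|exists v].
have clE u v : cl u = cl v -> nul s (u - v).
  by move=> E; apply/cl0; rewrite linearB E subrr.
exists G, rep; split.
- by move=> g; have [] := repP g.
- move=> a g h; apply: clE; rewrite linearP.
  by rewrite (repP _).2 (repP g).2 (repP h).2 linearP.
- by move=> g /cl0; rewrite (repP g).2 => E; apply: incI; rewrite E raddf0.
- move=> v hv; have [|g gE] := (incP (cl v)).1; first by exists v.
  by exists g; apply: clE; rewrite (repP g).2 gE.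
Qed.

(** * Purity of the hull, its homomorphisms and its rank *)

Section Hull.
Variables (G : lmodType R) (rep : G -> nat -> V).
Implicit Types (g h : G).
Hypothesis rep_hull : forall g, in_hull (rep g).
Hypothesis rep_lin : forall a g h, nul s (rep (a *: g + h) - (a *: rep g + rep h)).
Hypothesis rep_nul : forall g, nul s (rep g) -> g = 0.
Hypothesis rep_surj : forall v, in_hull v -> exists g, nul s (rep g - v).

(** The value [x] is admissible as the [n]-th coordinate of [g]. Computations in [G] go through this
    relation, which respects linear combinations although [rep] is linear only modulo null
    sequences. *)
Definition cong n (g : G) (x : V) := dvm (q n) (rep g n - x).

Lemma cong_lin n a g h x y : cong n g x -> cong n h y -> cong n (a *: g + h) (a *: x + y).
Proof.
move=> cg ch; rewrite /cong -(subrKA (a *: rep g n + rep h n)).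
apply: dvmD; first exact: rep_lin.
rewrite opprD addrACA -scalerBr; apply: dvmD; [exact: dvmZ|exact: ch].
Qed.

Lemma cong_refl n g : cong n g (rep g n).
Proof. by rewrite /cong subrr; exact: dvm0. Qed.

Lemma cong0 n : cong n 0 0.
Proof.
have := cong_lin (-1) (cong_refl n 0) (cong_refl n 0).
by rewrite !scaleN1r !addNr.
Qed.

Lemma congZ n a g x : cong n g x -> cong n (a *: g) (a *: x).
Proof. by move=> cg; have := cong_lin a cg (cong0 n); rewrite !addr0. Qed.

Lemma congD n g h x y : cong n g x -> cong n h y -> cong n (g + h) (x + y).
Proof. by move=> cg ch; have := cong_lin 1 cg ch; rewrite !scale1r. Qed.

Lemma congB n g h x y : cong n g x -> cong n h y -> cong n (g - h) (x - y).
Proof. by move=> cg /(congZ (-1)); rewrite !scaleN1r; exact: congD. Qed.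

Lemma cong_comb n (T : Type) (e : T -> G) (x : T -> V) l :
  (forall t, cong n (e t) (x t)) -> cong n (comb e l) (comb x l).
Proof.
move=> ex; elim: l => [|[c t] l IH]; first by rewrite !comb_nil; exact: cong0.
by rewrite !comb_cons; exact: cong_lin.
Qed.

Lemma cong_dvm n g x : cong n g x -> dvm (q n) (rep g n) <-> dvm (q n) x.
Proof.
move=> cg; split=> dg.
  by rewrite -(subKr (rep g n) x); exact: dvmB.
by rewrite -(subrK x (rep g n)); exact: dvmD.
Qed.

Lemma cong_eq0 g v : (forall n, cong n g (v n)) -> nul s v -> g = 0.
Proof. by move=> gv nv; apply: rep_nul => n; apply/(cong_dvm (gv n)). Qed.

Lemma hull_tf : S_torsion_free s G.
Proof.
move=> m g E; apply: rep_nul; apply: (nul_tf HS tfV (m := m)).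
  by have [] := rep_hull g.
move=> n; apply/(cong_dvm (congZ (s m) (cong_refl n g))); rewrite E.
by apply/(cong_dvm (cong0 n)); exact: dvm0.
Qed.

(** This is purity of [G]: the quotient by [q n] exists in the completion by [seq_divide], and the
    hull is closed under such quotients. *)
Lemma hull_dvm n g : dvm (q n) g <-> dvm (q n) (rep g n).
Proof.
split=> [[h ->]|dg].
  by apply/(cong_dvm (congZ (q n) (cong_refl n h))); exact: dvm_scale.
have [cg [m [k [l gE]]]] := rep_hull g.
have [z cz gz] := seq_divide HS tfV cg dg.
have [i Ei] := q_in_s HS n; have [j Ej] := s_mul HS m i.
have [|h hz] := @rep_surj z.
  split=> //; exists j, k, l; rewrite Ej Ei -scalerA.
  rewrite -(subrKA (s m *: rep g)); apply: nulD => //.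
  by rewrite -scalerBr; apply: nulZ; rewrite -opprB -scaleN1r; exact: nulZ.
exists h; apply/subr0_eq; apply: cong_eq0 gz => t.
apply: congB (cong_refl _ _) _; apply: congZ; exact: hz.
Qed.

Lemma hull_red g : (forall n, dvm (q n) g) -> g = 0.
Proof. by move=> dg; apply: rep_nul => n; apply/hull_dvm. Qed.

Lemma rep_gen k l : exists g, forall n, cong n g (gen k l n).
Proof. by have [g gE] := rep_surj (in_hull_gen k l); exists g. Qed.

(** This is the coordinate along [x]; it vanishes modulo null sequences exactly on [K], so it
    computes in [G/K]. *)
Definition sec (g : G) : nat -> R^o := fun n => (rep g n).2.

Lemma cong_sec n g x : cong n g x -> dvm (q n) (sec g n - x.2).
Proof. by move=> /dvm_pair[]. Qed.

Lemma cpt_sec g : cpt s (sec g).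
Proof. by have [cg _] := rep_hull g; move=> n; have /dvm_pair[] := cg n. Qed.

Lemma sec_comb g : exists m l, nul s (s m *: sec g - comb w l).
Proof.
have [_ [m [k [l gE]]]] := rep_hull g; exists m, l => n.
by have /dvm_pair[_] := gE n.
Qed.

Variables (iota : {linear K -> G}) (y : option J -> G).
Hypothesis iotaE : forall k n, cong n (iota k) (k, 0).
Hypothesis yE : forall o n, cong n (y o) (w' n *: eps o, w o n).

Lemma iota_inj : injective iota.
Proof.
apply: raddf_inj => k E; apply: (nul_cst redK) => n.
have := iotaE k n; rewrite E /cong => /dvm_pair[] /=.
have /dvm_pair[r0 _] := cong0 n.
by move=> rk _; have := dvmB r0 rk; rewrite subr0 subKr.
Qed.

Lemma sec_iota k : nul s (sec (iota k)).
Proof. by move=> n; have := cong_sec (iotaE k n); rewrite subr0. Qed.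

(* [K] is closed in [G]: this uses the independence of the [w o]. *)
Lemma sec_nul g : nul s (sec g) -> exists k, g = iota k.
Proof.
move=> ng; have [cg [m [k [l gE]]]] := rep_hull g.
have nl : nul s (comb w l).
  have -> : comb w l = s m *: sec g - (s m *: sec g - comb w l) by rewrite subKr.
  apply: nulB; first exact: nulZ.
  by move=> n; have /dvm_pair[_] := gE n.
have E0 : comb eps l = 0 by exact: nul_indep_comb (gf_indep gf) nl.
(* As [comb eps l = 0], the first coordinate of [s m *: g] is [k] modulo null sequences. At index
   [m], where [s m] divides [q m], this makes [k] a multiple of [s m]. *)
have [k' Ek] : dvm (s m) k.
  have [r qr] := s_dvd_q s (leqnn m); have /dvm_pair[] := gE m.
  rewrite [X in dvm _ X](_ : _ = s m *: (rep g m).1 - (k + w' m *: comb eps l)) //.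
  rewrite E0 scaler0 addr0 qr => /dvm_mulr kE _.
  by rewrite -(subKr (s m *: (rep g m).1) k); apply: dvmB => //; exact: dvm_scale.
exists k'; apply/subr0_eq; apply: (@cong_eq0 _ (rep g - pair_seq (cst k') (cst 0))).
  by move=> n; apply: congB; [exact: cong_refl|exact: iotaE].
apply: (nul_tf HS tfV (m := m)).
  by apply: cptB => //; apply/cpt_pair; split; exact: cpt_cst.
move=> n; apply/dvm_pair; split.
  have /dvm_pair[+ _] := gE n.
  rewrite [X in dvm _ X -> _](_ : _ = s m *: (rep g n).1 - (k + w' n *: comb eps l)) //.
  rewrite [X in _ -> dvm _ X](_ : _ = s m *: ((rep g n).1 - k')) //.
  by rewrite E0 scaler0 addr0 Ek scalerBr.
rewrite [X in dvm _ X](_ : _ = s m *: ((rep g n).2 - 0)) // subr0.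
exact: dvmZ.
Qed.

Lemma hull_gen g : exists m k l, s m *: g = iota k + comb y l.
Proof.
have [_ [m [k [l gE]]]] := rep_hull g; exists m, k, l.
apply/subr0_eq; apply: cong_eq0 gE => n.
apply: congB; first exact/congZ/cong_refl.
have := congD (iotaE k n) (cong_comb l (fun o => yE o n)).
by rewrite -genE.
Qed.

(** This is the defining equation of [y o] truncated modulo [q n]. By purity the divisibility holds
    inside [G], so homomorphisms preserve it. *)
Lemma hull_approx o n : dvm (q n) (y o - w o n *: y None - w' n *: iota (eps o)).
Proof.
apply/hull_dvm.
have E := congB (congB (yE o n) (congZ (w o n) (yE None n)))
  (congZ (w' n) (iotaE (eps o) n)).
apply/(cong_dvm E); rewrite (gf_one gf) eps0.
rewrite [X in dvm _ X](_ : _ = 0); first exact: dvm0.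
congr (_, _) => /=; first by rewrite !scaler0 subr0 subrr.
by rewrite [LHS](_ : _ = w o n - w o n * 1 - w' n * 0) // mulr1 mulr0 subrr subr0.
Qed.

Lemma hom_zero (Q : lmodType R) (f : {linear G -> Q}) : S_torsion_free s Q ->
  (forall o, f (iota (eps o)) = 0) -> (forall o, f (y o) = 0) -> forall g, f g = 0.
Proof.
move=> tfQ fe fy.
have fcomb (T : Type) (e : T -> G) l : (forall t, f (e t) = 0) -> f (comb e l) = 0.
  by move=> fe0; rewrite linear_sum big1 // => p _; rewrite linearZ /= fe0 scaler0.
have fi k : f (iota k) = 0.
  have [m [l E]] := eps_span k; apply: (tfQ m).
  rewrite -!linearZ /= E linear_sum linear_sum big1 // => p _.
  by rewrite !linearZ /= fe scaler0.
move=> g; have [m [k [l E]]] := hull_gen g; apply: (tfQ m).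
by rewrite -linearZ /= E linearD fi fcomb // addr0.
Qed.

Lemma hom_approx (Q : lmodType R) (f : {linear G -> Q}) o n :
  dvm (q n) (w o n *: f (y None) + w' n *: f (iota (eps o)) - f (y o)).
Proof.
have [h E] := hull_approx o n; exists (- f h).
have := congr1 f E; rewrite !linearB !linearZ /= => {}E.
by rewrite scalerN -E !scalerN 2!opprB addrA; congr (_ - _); exact: addrC.
Qed.

(** The relation for [j0] gives [f e = 0] for its [eps] through the genericity of [w'], then
    [f x = 0] through that of [w (Some j0)]. Once [f x = 0], the term with [w o] drops out and
    [gf_K'] applies to every [o]. *)
Lemma hom_K_zero (f : {linear G -> K}) g : f g = 0.
Proof.
have e0 : f (iota (eps (Some j0))) = 0 by apply: (gf_K' gf); exact: hom_approx.
have x0 : f (y None) = 0.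
  apply: (gf_K gf) (f (y (Some j0))) _ => n; have := hom_approx f (Some j0) n.
  by rewrite e0 scaler0 addr0.
have fe o : f (iota (eps o)) = 0.
  apply: (gf_K' gf (k0 := 0) (k2 := f (y o))) => n; have := hom_approx f o n.
  rewrite x0 scaler0 => fo.
  by rewrite [X in dvm _ X](_ : _ = w (Some j0) n *: 0 + w' n *: f (iota (eps o)) -
    f (y o)) // scaler0.
have fy o : f (y o) = 0.
  apply: (nul_cst redK) => n; have := hom_approx f o n.
  by rewrite x0 fe !scaler0 add0r sub0r => /dvmN; rewrite opprK.
exact: hom_zero.
Qed.

(** By continuity [f v = v * f 1]. For [v = w'], genericity over the span of [w] forces [f 1] into
    [K]; then [f w'] lies in [K] as well, and genericity over [K] gives [f 1 = 0]. *)
Lemma hull_cotorsion_free : cotorsion_free s G.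
Proof.
move=> f fD fZ fN v0 cv0.
pose one : nat -> R := fun=> 1.
have cone : compat s one by exact: (@cpt_cst _ s R^o).
have fapp v n : compat s v -> dvm (q n) (f v - v n *: f one).
  move=> cv.
  (* The sequence [v - v n] vanishes at index [n], so it is [q n] times an element of the
     completion, up to the null sequence [d]. *)
  have cvn : cpt s ((v : nat -> R^o) - cst (v n : R^o)) by apply: cptB => //; exact: cpt_cst.
  have [|z cz nz] := seq_divide HS tfR (m := n) cvn.
    by rewrite [X in dvm _ X](_ : _ = v n - v n) // subrr; exact: dvm0.
  set d := _ - _ in nz.
  have cd : compat s d by exact: (cptB cvn (cptZ (q n) cz)).
  have cz' : compat s (fun k => q n * z k) by exact: (cptZ (q n) cz).
  have cv' : compat s (fun k => v n * one k) by exact: (cptZ (v n) (@cpt_cst _ s R^o 1)).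
  have -> : v = (fun k => (fun j => v n * one j + q n * z j) k + d k).
    apply/funext => k; rewrite [d k](_ : _ = v k - v n - q n * z k) // /one; ring.
  rewrite fD //; last exact: (@cptD _ s R^o _ _ cv' cz').
  rewrite fD // fZ // fZ // (fN d) // addr0.
  have -> : v n * one n + q n * z n + d n = v n.
    by rewrite [d n](_ : _ = v n - v n - q n * z n) // /one; ring.
  by rewrite addrAC subrr add0r; exact: dvm_scale.
have frep v n : compat s v -> dvm (q n) (rep (f v) n - v n *: rep (f one) n).
  move=> /(fapp _ n) /hull_dvm.
  by have E := congB (cong_refl n (f v)) (congZ (v n) (cong_refl n (f one)));
    move/(cong_dvm E).
have cw' := gf_cpt' gf.
have n1 : nul s (sec (f one)).
  have [m [l nl]] := sec_comb (f one); have [m' [l' nl']] := sec_comb (f w').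
  have [i si] := s_mul HS m m'.
  suff /(gf_quad' gf (l0 := [::])) : nul s (smul (w (Some j0)) (comb w [::]) +
      smul w' (comb w (scale_comb (s m') l)) - comb w (scale_comb (s m) l')).
    rewrite combZ => nc; apply: (nul_tf HS tfR (cpt_sec _) (m := i)) => n.
    rewrite [X in dvm _ X](_ : _ = s m' * (s m * sec (f one) n - comb w l n) +
       s m' * comb w l n); last by rewrite [LHS](_ : _ = s i * sec (f one) n) // si; ring.
    by apply: dvmD; [exact: (dvmZ _ (nl n))|exact: nc].
  rewrite comb_nil !combZ => n; have /dvm_pair[_ fr] := frep _ n cw'.
  rewrite [X in dvm _ X](_ : _ = - (s i *: (sec (f w') n - w' n *: sec (f one) n)) +
     (s m *: (s m' *: sec (f w') - comb w l') n) -
     (s m' * w' n) *: (s m *: sec (f one) - comb w l) n).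
    by apply: dvmB; [apply: dvmD; [exact/dvmN/dvmZ|exact/dvmZ]|exact/dvmZ].
  rewrite [LHS](_ : _ = w (Some j0) n * 0 + w' n * (s m' * comb w l n) - s m * comb w l' n) //.
  rewrite [RHS](_ : _ = - (s i * (sec (f w') n - w' n * sec (f one) n)) +
     (s m * (s m' * sec (f w') n - comb w l' n)) -
     (s m' * w' n) * (s m * sec (f one) n - comb w l n)) // si.
  by move: (comb w l n) (comb w l' n) => X Y; ring.
have fiota v : compat s v -> exists k, f v = iota k.
  move=> cv; apply: sec_nul => n; have /dvm_pair[_ fr] := frep _ n cv.
  by rewrite -(subrK (v n *: sec (f one) n) (sec _ n)); apply: dvmD => //; exact: dvmZ.
have [k Ek] := fiota _ cone; have [k' Ek'] := fiota _ cw'.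
have k0 : k = 0.
  apply: (gf_K' gf (k0 := 0) (k2 := k')) => n.
  have : dvm (q n) (iota (w' n *: k - k')).
    by rewrite linearB linearZ -Ek -Ek' -opprB; exact/dvmN/fapp.
  move=> /hull_dvm /(cong_dvm (iotaE _ n)) /dvm_pair[+ _]; congr dvm.
  rewrite [RHS](_ : _ = w (Some j0) n *: 0 + w' n *: k - k') //.
  by rewrite scaler0 add0r.
apply: hull_red => n; have := fapp _ n cv0.
by rewrite Ek k0 linear0 scaler0 subr0.
Qed.

Lemma hull_card X : card_le nat X -> card_le R X -> card_le K X -> card_le J X ->
  card_le G X.
Proof.
move=> natX RX KX JX.
apply: (@card_le_trans (nat * K * seq (R * option J))); last first.
  apply: card_le_prodX => //; first exact: card_le_prodX.
  by apply: card_le_seqX => //; apply: card_le_prodX => //; exact: card_le_optionX.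
have /choice[f fP] : forall g, exists x : nat * K * seq (R * option J),
    s x.1.1 *: g = iota x.1.2 + comb y x.2.
  by move=> g; have [m [k [l E]]] := hull_gen g; exists (m, k, l).
exists f => g h E; apply: (s_cancel hull_tf (m := (f g).1.1)).
by rewrite fP E fP.
Qed.

(** In a relation among the [iota (e i)] and the [y o], the second coordinate is a null combination
    of the [w o], so the coefficients of the [y o] vanish; what remains is a relation in [K]. *)
Lemma hull_rank (I : eqType) (e : I -> K) : lin_indep e ->
  (forall k, exists n, in_span e (s n *: k)) ->
  exists E : I + option J -> G,
    lin_indep E /\ forall g, exists n, in_span E (s n *: g).
Proof.
move=> eI eS; pose E t := match t with inl i => iota (e i) | inr o => y o end.
exists E; split=> [l c ul|g].
  pose li := pmap (fun t => if t is inl i then Some i else None) l.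
  pose lo := pmap (fun t : I + option J => if t is inr o then Some o else None) l.
  have mli i : (i \in li) = (inl i \in l).
    by rewrite mem_pmap; apply/mapP/idP => [[[j|j]// jl [->]]//|il]; exists (inl i).
  have mlo o : (o \in lo) = (inr o \in l).
    by rewrite mem_pmap; apply/mapP/idP => [[[j|j]// jl [->]]//|il]; exists (inr o).
  have uli : uniq li.
    by apply: (pmap_uniq (g := inl)) ul => -[].
  have ulo : uniq lo.
    by apply: (pmap_uniq (g := inr)) ul => -[].
  have pl : perm_eq l (map inl li ++ map inr lo).
    apply: uniq_perm => //.
      rewrite cat_uniq !map_inj_uniq ?uli ?ulo ?andbT /=; try by move=> ? ? [].
      by apply/hasPn => _ /mapP[o _ ->]; apply/mapP => -[].
    move=> t; rewrite mem_cat; case: t => [i|o].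
      rewrite (mem_map (fun _ _ => _)) ?mli; last by move=> ? ? [].
      by case: mapP => [[]//|_]; rewrite orbF.
    rewrite (mem_map (f := inr)) ?mlo; last by move=> ? ? [].
    by case: mapP => [[]//|_].
  rewrite (perm_big _ pl) big_cat !big_map /= => sum0.
  have c_o o : o \in lo -> c (inr o) = 0.
    move: o; suff nlo : nul s (\sum_(o <- lo) c (inr o) *: w o).
      exact: (gf_indep gf ulo nlo).
    move=> n; rewrite fct_sumE.
    have Ei : \sum_(i <- li) c (inl i) *: iota (e i) = iota (\sum_(i <- li) c (inl i) *: e i).
      by rewrite linear_sum; apply: eq_bigr => i _; rewrite linearZ.
    have := congD (iotaE (\sum_(i <- li) c (inl i) *: e i) n)
      (cong_comb [seq (c (inr o), o) | o <- lo] (fun o => yE o n)).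
    rewrite -Ei -comb_sum sum0 => E0.
    have /(cong_dvm E0) /dvm_pair[_] : dvm (q n) (rep 0 n).
      by apply/(cong_dvm (cong0 n)); exact: dvm0.
    rewrite -comb_sum /= add0r; congr dvm.
    by elim: lo {E0 ulo mlo pl sum0} => [|o lo IH]; rewrite ?big_nil // !big_cons -IH.
  have c_i i : i \in li -> c (inl i) = 0.
    apply: (eI _ (c \o inl)) => //=; apply: iota_inj; rewrite linear0 -[RHS]sum0.
    have -> : \sum_(o <- lo) c (inr o) *: y o = 0.
      by rewrite big_seq big1 // => o ol; rewrite c_o // scale0r.
    rewrite addr0 linear_sum.
    by apply: eq_bigr => i' _; rewrite linearZ.
  by move=> [i|o]; rewrite -?mli -?mlo; [exact: c_i|exact: c_o].
have [m [k [l gE]]] := hull_gen g; have [n [li [c kE]]] := eS k.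
have [i si] := s_mul HS n m; exists i.
suff [l' E'] : exists l', s i *: g = comb E l'.
  by rewrite E' comb_regroup; eexists; exists (fun t => \sum_(p <- l' | p.2 == t) p.1).
exists ([seq (c j, inl j) | j <- li] ++ [seq (s n * p.1, inr p.2) | p <- l]).
rewrite si -scalerA gE scalerDr -linearZ /= kE comb_cat /comb !big_map; congr (_ + _).
  by rewrite linear_sum; apply: eq_bigr => j _; rewrite linearZ.
by rewrite scaler_sumr; apply: eq_bigr => p _; rewrite scalerA.
Qed.

(** * Homomorphisms into [G/K] *)

Section Quotient.
Variables (Q : lmodType R) (pi : {linear G -> Q}).
Hypothesis pi_surj : forall z, exists g, pi g = z.
Hypothesis pi_ker : forall g, pi g = 0 <-> exists k, g = iota k.

(** Through [sec] the quotient embeds in the completion of [R], from which it inherits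
    torsion-freeness and reducedness. *)
Lemma pi_sec g : pi g = 0 <-> nul s (sec g).
Proof.
by rewrite pi_ker; split=> [[k ->]|]; [exact: sec_iota|exact: sec_nul].
Qed.

Lemma pi_dvm n g : dvm (q n) (pi g) -> dvm (q n) (sec g n).
Proof.
move=> [z]; have [h <-] := pi_surj z; rewrite -linearZ => /eqP.
rewrite -subr_eq0 -linearB => /eqP/pi_ker[k /eqP]; rewrite subr_eq addrC => /eqP->.
have /cong_sec := cong_lin (q n) (cong_refl n h) (iotaE k n).
rewrite /= addr0 => d.
by rewrite -(subrK (q n *: (rep h n).2) (sec _ n)); apply: dvmD => //; exact: dvm_scale.
Qed.

Lemma pi_tf : S_torsion_free s Q.
Proof.
move=> m z; have [g <-] := pi_surj z; rewrite -linearZ => /pi_sec ng.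
apply/pi_sec; apply: (nul_tf HS tfR (cpt_sec g) (m := m)) => n.
have /cong_sec := congZ (s m) (cong_refl n g) => d.
by have := dvmB (ng n) d; rewrite subKr.
Qed.

Lemma pi_red (z : Q) : (forall n, dvm (q n) z) -> z = 0.
Proof. by have [g <-] := pi_surj z => dz; apply/pi_sec => n; exact: pi_dvm. Qed.

Lemma hom_sec (f : {linear G -> Q}) o gx ge gy :
  f (y None) = pi gx -> f (iota (eps o)) = pi ge -> f (y o) = pi gy ->
  nul s (smul (w o) (sec gx) + smul w' (sec ge) - sec gy).
Proof.
move=> Ex Ee Ey n; have := hom_approx f o n; rewrite Ex Ee Ey.
rewrite -!linearZ -linearD -linearB => /pi_dvm dg.
have /cong_sec := congB (cong_lin (w o n) (cong_refl n gx)
  (congZ (w' n) (cong_refl n ge))) (cong_refl n gy).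
by move=> /(dvmB dg); rewrite subKr.
Qed.

Lemma sec_comb3 g1 g2 g3 : exists m l1 l2 l3,
  [/\ nul s (s m *: sec g1 - comb w l1), nul s (s m *: sec g2 - comb w l2) &
      nul s (s m *: sec g3 - comb w l3)].
Proof.
have [m1 [l1 n1]] := sec_comb g1; have [m2 [l2 n2]] := sec_comb g2.
have [m3 [l3 n3]] := sec_comb g3.
have [i si] := s_mul HS m1 m2; have [j sj] := s_mul HS i m3.
exists j, (scale_comb (s m2 * s m3) l1), (scale_comb (s m1 * s m3) l2),
  (scale_comb (s m1 * s m2) l3).
rewrite !combZ sj si; split.
- rewrite (_ : _ * s m3 = s m2 * s m3 * s m1); last by ring.
  by rewrite -[(_ * s m1) *: _]scalerA -scalerBr; exact: nulZ.
- by rewrite mulrAC -[(_ * s m2) *: _]scalerA -scalerBr; exact: nulZ.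
- by rewrite -[(_ * s m3) *: _]scalerA -scalerBr; exact: nulZ.
Qed.

(** Clearing denominators turns the relation between values of [f] into one between combinations of
    [w], to which genericity applies. *)
Lemma hom_comb (f : {linear G -> Q}) o gx ge gy :
  f (y None) = pi gx -> f (iota (eps o)) = pi ge -> f (y o) = pi gy ->
  exists m l0 l1 l2,
    [/\ nul s (s m *: sec gx - comb w l0), nul s (s m *: sec ge - comb w l1) &
     nul s (smul (w o) (comb w l0) + smul w' (comb w l1) - comb w l2)].
Proof.
move=> Ex Ee Ey; have rel := hom_sec Ex Ee Ey.
have [m [l0 [l1 [l2 [n0 n1 n2]]]]] := sec_comb3 gx ge gy.
exists m, l0, l1, l2; split=> //.
rewrite (_ : _ - _ = s m *: (smul (w o) (sec gx) + smul w' (sec ge) - sec gy) -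
  (smul (w o) (s m *: sec gx - comb w l0) + smul w' (s m *: sec ge - comb w l1) -
   (s m *: sec gy - comb w l2))).
  apply: nulB; first exact: nulZ.
  by apply: nulB => //; apply: nulD; exact: nul_smul.
apply/funext => n.
rewrite [LHS](_ : _ = w o n * comb w l0 n + w' n * comb w l1 n - comb w l2 n) //.
rewrite [RHS](_ : _ = s m * (w o n * sec gx n + w' n * sec ge n - sec gy n) -
  (w o n * (s m * sec gx n - comb w l0 n) + w' n * (s m * sec ge n - comb w l1 n) -
   (s m * sec gy n - comb w l2 n))) //.
by move: (comb w l0 n) (comb w l1 n) (comb w l2 n) => X Y Z; ring.
Qed.

Lemma sec_nul_comb m g l : nul s (s m *: sec g - comb w l) -> nul s (comb w l) ->
  nul s (sec g).
Proof.
move=> ng nl; apply: (nul_tf HS tfR (cpt_sec g) (m := m)).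
by rewrite -(subrK (comb w l) (s m *: sec g)); exact: nulD.
Qed.

(** [gf_quad'] removes the term with [w'], and [gf_quad] then makes [s m *: sec gx] a constant [c].
    The coefficient [r] is the quotient of [c] by [s m], which exists because [s m] divides
    [q m]. *)
Lemma hom_one (f : {linear G -> Q}) : exists r, f (y None) = r *: pi (y None).
Proof.
have [gx Ex] := pi_surj (f (y None)).
have [ge Ee] := pi_surj (f (iota (eps (Some j0)))).
have [gy Ey] := pi_surj (f (y (Some j0))).
have [m [l0 [l1 [l2 [n0 n1 rel]]]]] := hom_comb (esym Ex) (esym Ee) (esym Ey).
have nl1 := gf_quad' gf rel.
have [|c nc] := gf_quad gf (l := l0) (l' := l2).
  rewrite (_ : _ - _ = (smul (w (Some j0)) (comb w l0) + smul w' (comb w l1) -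
    comb w l2) - smul w' (comb w l1)); first by apply: nulB => //; exact: nul_smul.
  by rewrite addrAC addrK.
have {}nc : nul s (s m *: sec gx - cst c).
  by rewrite -(subrKA (comb w l0)); exact: nulD.
have [r cE] : dvm (s m) c.
  have [d qd] := s_dvd_q s (leqnn m); have := nc m; rewrite qd => /dvm_mulr dc.
  by rewrite -(subKr (s m *: sec gx m) c); apply: dvmB => //; exact: dvm_scale.
exists r; rewrite -Ex -linearZ; apply/eqP; rewrite -subr_eq0 -linearB; apply/eqP/pi_sec.
suff nx : nul s (sec gx - cst r).
  move=> n; have /cong_sec := congB (cong_refl n gx) (congZ r (yE None n)).
  rewrite (gf_one gf) [X in dvm _ X -> _](_ : _ = sec (gx - r *: y None) n -
    (sec gx n - r * 1)) // mulr1 => d.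
  by rewrite -(subrK (sec gx n - r) (sec _ n)); apply: dvmD => //; exact: nx.
apply: (nul_tf HS tfR (m := m)); first by apply: cptB; [exact: cpt_sec|exact: cpt_cst].
move: nc; congr nul; rewrite scalerBr; congr (_ - _).
by apply/funext => n; rewrite /cst cE.
Qed.

(** Without the contribution of [x], every relation is linear in [w'], so all [f e_o] vanish; then
    each [f (y o)] is divisible by every [q n]. *)
Lemma hom_Q_zero (f : {linear G -> Q}) : f (y None) = 0 -> forall g, f g = 0.
Proof.
move=> x0; have fe o : f (iota (eps o)) = 0.
  have [ge Ee] := pi_surj (f (iota (eps o))).
  have [gy Ey] := pi_surj (f (y o)).
  have Ex : f (y None) = pi 0 by rewrite linear0.
  have [m [l0 [l1 [l2 [n0 n1 rel]]]]] := hom_comb Ex (esym Ee) (esym Ey).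
  rewrite -Ee; apply/pi_sec; apply: (sec_nul_comb n1).
  have nl0 : nul s (comb w l0).
    rewrite -(subKr (s m *: sec 0) (comb w l0)); apply: nulB => //; apply: nulZ.
    by apply/pi_sec; rewrite linear0.
  apply: (gf_quad' gf (l0 := [::]) (l2 := l2)).
  rewrite (_ : _ - _ = (smul (w o) (comb w l0) + smul w' (comb w l1) - comb w l2) -
    smul (w o) (comb w l0)); first by apply: nulB => //; exact: nul_smul.
  rewrite [RHS]addrAC [X in _ = X - _ - _]addrC addrK.
  rewrite comb_nil (_ : smul _ 0 = 0) ?add0r //.
  by apply/funext => n; exact: scaler0.
have fy o : f (y o) = 0.
  apply: pi_red => n; have := hom_approx f o n.
  by rewrite x0 fe !scaler0 add0r sub0r => /dvmN; rewrite opprK.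
exact: (hom_zero pi_tf).
Qed.

Lemma hom_Q (f : {linear G -> Q}) : exists r, forall g, f g = r *: pi g.
Proof.
have [r fx] := hom_one f.
have [|f' f'E] := @linear_exists R G Q (fun g => f g - r *: pi g).
  move=> a g h; rewrite (linearP f) (linearP pi) scalerBr scalerDr !scalerA.
  by rewrite [r * a]mulrC opprD addrACA.
exists r => g; apply/subr0_eq; rewrite -f'E; apply: hom_Q_zero.
by rewrite f'E fx subrr.
Qed.

End Quotient.

End Hull.

End Construction.

(** * Cardinalities, ranks and assembly of the result *)

Lemma card_le_nat_ring (R : comNzRingType) (s : nat -> R) :
  S_torsion_free s R^o -> S_reduced s R^o -> card_le nat R.
Proof.
(* Some [s n] is not a unit, since otherwise [1] would be divisible by every [s n] and vanish by
   reducedness. Its powers are distinct because it is not a zero divisor. *)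
move=> tfR redR; have [n np] : exists n, ~ exists r : R^o, (1 : R^o) = s n *: r.
  apply: contrapT => nex; have /eqP := oner_neq0 R; apply; apply: redR => n.
  by apply: contrapT => nn; apply: nex; exists n.
have cancel k (x y : R) : s n ^+ k * x = s n ^+ k * y -> x = y.
  elim: k => [|k IH]; first by rewrite !mul1r.
  rewrite exprS -!mulrA => E; apply: IH; apply: (@s_cancel _ s R^o tfR n); exact: E.
have le i j : (i < j)%N -> s n ^+ i <> s n ^+ j.
  move=> ij E; apply: np; exists (s n ^+ (j - i).-1); apply: (cancel i).
  rewrite mulr1 [LHS]E -{1}(subnKC (ltnW ij)) exprD; congr (_ * _).
  by rewrite [RHS](_ : _ = s n * s n ^+ (j - i).-1) // -exprS prednK ?subn_gt0.
exists (fun k => s n ^+ k) => i j E.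
by case: (ltngtP i j) => // [/le|/le/nesym].
Qed.

Lemma basis_reindex (R : comNzRingType) (s : nat -> R) (M : lmodType R)
  (T T' : eqType) (E : T -> M) : card_eq T' T -> lin_indep E ->
  (forall m, exists n, in_span E (s n *: m)) ->
  exists E' : T' -> M, lin_indep E' /\ forall m, exists n, in_span E' (s n *: m).
Proof.
move=> [h [h' hK h'K]] EI ES; exists (E \o h); split=> [l c ul sum0 t tl|m].
  rewrite -[t]hK; apply: (EI (map h l) (c \o h')); last exact: map_f.
    by rewrite map_inj_uniq //; exact: can_inj hK.
  rewrite big_map -[RHS]sum0; apply: eq_bigr => t' _.
  by rewrite /= hK.
have [n [l [c mE]]] := ES m; exists n, (map h' l), (c \o h).
by rewrite mE big_map; apply: eq_bigr => t _; rewrite /= h'K.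
Qed.

Section CellularHull.
Variables (R : comNzRingType) (s : nat -> R) (K : lmodType R) (J : eqType) (j0 : J).
Hypotheses (HS : mult_closed s) (tfR : S_torsion_free s R^o) (redR : S_reduced s R^o).
Hypotheses (tfK : S_torsion_free s K) (redK : S_reduced s K).

Lemma cellular_hull_exists (X : Type) (eps : option J -> K) :
  card_le nat X -> ~ card_le (nat -> bool) X ->
  card_le R X -> card_le K X -> card_le J X ->
  eps None = 0 -> (forall k, exists m l, s m *: k = comb eps l) ->
  exists (G : lmodType R) (iota : {linear K -> G})
         (Q : lmodType R) (pi : {linear G -> Q}),
    [/\ injective iota, forall z, exists g, pi g = z,
        forall g, pi g = 0 <-> exists k, g = iota k & cotorsion_free s G] /\
    [/\ forall (f : {linear G -> K}) g, f g = 0,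
        forall f : {linear G -> Q}, exists r, forall g, f g = r *: pi g,
        card_le G X &
        forall (I : eqType) (e : I -> K), lin_indep e ->
          (forall k, exists n, in_span e (s n *: k)) ->
          exists E : I + option J -> G,
            lin_indep E /\ forall g, exists n, in_span E (s n *: g)].
Proof.
move=> natX smallX RX KX JX eps0 epsS.
have [w [w' gf]] := generic_family_exists j0 HS tfR redR tfK redK natX smallX RX KX JX.
have [G [rep [rh rl rn rs]]] := hull_exists HS w w' eps.
have gen_surj := rep_gen HS gf rs.
have /choice[i0 i0E] : forall k, exists g, forall n, cong s rep n g (k, 0).
  move=> k; have [g gE] := gen_surj k [::]; exists g => n.
  by have := gE n; rewrite genE comb_nil addr0.
have /choice[y yE] : forall o, exists g, forall n, cong s rep n g (w' n *: eps o, w o n).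
  move=> o; have [g gE] := gen_surj 0 [:: (1, o)]; exists g => n.
  by have := gE n; rewrite genE comb1 scale1r add0r.
have [|iota iotaE'] := @linear_exists R K G i0.
  move=> a k k'; apply/subr0_eq; apply: (cong_eq0 rn (v := cst 0)) => [n|n].
    have := congB rl (i0E (a *: k + k') n) (cong_lin rl a (i0E k n) (i0E k' n)).
    congr cong; congr (_, _) => /=; first by rewrite subrr.
    by rewrite [LHS](_ : _ = 0 - (a * 0 + 0)) // mulr0 addr0 subrr.
  exact: dvm0.
have iotaE k n : cong s rep n (iota k) (k, 0) by rewrite iotaE'.
have [|Q [pi [piS pi0]]] := @quotmod_exists R G (fun g => exists k, g = iota k).
  split; first by exists 0; rewrite linear0.
  by move=> a _ _ [k ->] [k' ->]; exists (a *: k + k'); rewrite linearP.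
exists G, iota, Q, pi; split; split=> //.
- exact: (iota_inj redK rl iotaE).
- exact: (hull_cotorsion_free HS tfR tfK gf rh rl rn rs iotaE).
- by move=> f g; apply: (hom_K_zero HS tfR tfK redK gf eps0 epsS rh rl rn rs iotaE yE).
- exact: (hom_Q HS tfR tfK gf eps0 epsS rh rl rn rs iotaE yE piS pi0).
- exact: (hull_card HS tfR tfK rh rl rn iotaE yE natX RX KX JX).
- by move=> I e; exact: (hull_rank HS redK gf rh rl rn iotaE yE).
Qed.

End CellularHull.

Lemma card_eq_ord3 (I : Type) (i0 : I) :
  card_eq I unit -> card_eq 'I_3 (I + option unit).
Proof.
move=> [u /bij_inj uI]; have Ii i : i = i0 by apply: uI; case: (u i); case: (u i0).
exists (fun k : 'I_3 => match val k with
  0 => inl i0 | 1 => inr None | _ => inr (Some tt) end).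
exists (fun t => match t with
  inl _ => inord 0 | inr None => inord 1 | inr (Some _) => inord 2 end).
  by move=> [[|[|[|]]] //= k3]; apply: val_inj; rewrite /= inordK.
by move=> [i|[[]|]]; rewrite /= inordK // (Ii i).
Qed.

Lemma card_eq_option_sum (I : Type) :
  card_eq (option ((I + I) + I)) (I + option (I + I)).
Proof.
exists (fun t => match t with
  None => inr None | Some (inl x) => inr (Some x) | Some (inr i) => inl i end).
by exists (fun t => match t with
  inl i => Some (inr i) | inr None => None | inr (Some x) => Some (inl x) end);
  [move=> [[]|]|move=> [|[]]].
Qed.

Lemma lin_indep_inj (R : comNzRingType) (M : lmodType R) (I : eqType) (e : I -> M) :
  lin_indep e -> injective e.
Proof.
move=> eI i j E; apply: contrapT => ne; have /eqP := oner_neq0 R; apply.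
pose c k : R := if k == i then 1 else -1.
rewrite -(_ : c i = 1); last by rewrite /c eqxx.
apply: (eI [:: i; j]); rewrite ?mem_head //= ?inE ?andbT; first exact/eqP.
rewrite !big_cons big_nil addr0 E -scalerDl /c eqxx.
by case: eqP => [/esym//|_]; rewrite subrr scale0r.
Qed.

Theorem theorem3p2 (R : comNzRingType) (s : nat -> R)
    (HS : mult_closed s)
    (HRtf : S_torsion_free s R^o) (HRred : S_reduced s R^o)
    (HRcard : card_lt R (nat -> bool))
    (K : lmodType R) (HKtf : S_torsion_free s K) (HKred : S_reduced s K)
    (I : eqType) (i0 : I) (HIcard : card_lt I (nat -> bool))
    (HKrank : has_rank s K I) :
  exists (G : lmodType R) (iota : {linear K -> G})
         (Q : lmodType R) (pi : {linear G -> Q}),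
    (* 0 -> K -> G -> Q -> 0 exact, i.e. Q = G/K and pi the canonical map *)
    injective iota /\
    (forall y : Q, exists g : G, pi g = y) /\
    (forall g : G, pi g = 0 <-> exists k : K, g = iota k) /\
    cotorsion_free s G /\
    (card_eq I unit -> has_rank s G 'I_3) /\
    (~ card_eq I unit -> has_rank s G (option ((I + I) + I))%type) /\
    (* Hom_R(G, K) = 0 *)
    (forall (f : {linear G -> K}) (g : G), f g = 0) /\
    (* Hom_R(G, G/K) = pi R *)
    (forall f : {linear G -> Q}, exists r : R, forall g : G, f g = r *: pi g) /\
    (* cellular: pi_* : Hom(G,G) -> Hom(G,G/K) is bijective *)
    (forall phi psi : {linear G -> G},
        (forall g, pi (phi g) = pi (psi g)) -> forall g, phi g = psi g) /\
    (forall f : {linear G -> Q}, exists phi : {linear G -> G},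
        forall g, f g = pi (phi g)).
Proof.
have natR := card_le_nat_ring HRtf HRred.
(* [X] bounds all the cardinals that are counted: it is [K] when [K] is larger than [R], and [R]
   otherwise. In the first case [e] enumerates all of [K]; in the second it is an independent family
   spanning [K] up to torsion. *)
have [X [e [natX smallX [RX KX IX] eS Xcase]]] : exists (X : Type) (e : I -> K),
    [/\ card_le nat X, ~ card_le (nat -> bool) X,
       [/\ card_le R X, card_le K X & card_le I X],
       forall k, exists n, in_span e (s n *: k) &
       [/\ card_lt R K, card_eq K I & card_le X K] \/ card_le X R /\ lin_indep e].
  case: HKrank => [[ltRK KI]|[KR [e [eI eS]]]].
    have [RK _] := ltRK; have [f [e fK eK]] := KI; exists K, e; split=> //.
    - exact: card_le_trans natR RK.
    - by move=> /card_le_trans /(_ (card_eq_le KI)); case: HIcard.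
    - by split=> //; [exact: card_le_refl|exact/card_eq_le/card_eq_sym].
    - move=> k; have [[m sm] _] := HS; exists m, [:: f k], (fun=> 1).
      by rewrite big_seq1 sm fK.
    - by left; split=> //; exact: card_le_refl.
  exists R, e; split=> //; first by case: HRcard.
    split=> //; first exact: card_le_refl.
    by apply: card_le_trans KR; exists e; exact: lin_indep_inj.
  by right; split=> //; exact: card_le_refl.
(* [J] is a point when [I] is one, and two copies of [I] otherwise, so that [I + option J] has size
   [3] or [3 kappa + 1]. *)
have [J [j0 [p [r [rK JX JT]]]]] : exists (J : eqType) (j0 : J) (p : J -> I) (r : I -> J),
    [/\ cancel r p, card_le J X &
      (card_eq I unit -> card_eq 'I_3 (I + option J)) /\
      (~ card_eq I unit -> card_eq (option ((I + I) + I)) (I + option J))].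
  have [Iu|nIu] := pselect (card_eq I unit).
    exists unit, tt, (fun=> i0), (fun=> tt); split.
    - by move=> i; have [u /bij_inj uI] := Iu; apply: uI; case: (u i0); case: (u i).
    - by apply: card_le_trans natX; exists (fun=> 0%N); case; case.
    - by split=> // _; exact: card_eq_ord3.
  exists (I + I)%type, (inl i0), (fun t => match t with inl i => i | inr i => i end), inl.
  split=> //; first exact: card_le_sumX.
  by split=> // _; exact: card_eq_option_sum.
pose eps o := if o is Some j then e (p j) else 0.
have [|G [iota [Q [pi [[iotaI piS pi0 ctf] [homK homQ GX rk]]]]]] :=
  cellular_hull_exists j0 HS HRtf HRred HKtf HKred (eps := eps) natX smallX RX KX JX erefl.
  move=> k; have [n [l [c E]]] := eS k; exists n, [seq (c i, Some (r i)) | i <- l].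
  by rewrite E /comb big_map; apply: eq_bigr => i _; rewrite /= rK.
have rank (T : eqType) : card_eq T (I + option J) -> has_rank s G T.
  move=> TE; have [[[RK nKR] KI XK]|[XR eI]] := Xcase; last first.
    right; split; first exact: card_le_trans GX XR.
    have [E [EI ES]] := rk _ _ eI eS; exact: basis_reindex TE EI ES.
  have KG : card_le K G by exists iota.
  (* Here rank means cardinality: [X], [K], [I], [G] and [I + option J] are all equipotent. *)
  left; split; first split.
  - exact: card_le_trans RK KG.
  - by move=> GR; apply: nKR; exact: card_le_trans KG GR.
  apply: card_le_antisym.
    apply: card_le_trans (card_le_trans GX XK) _.
    apply: card_le_trans (card_eq_le KI) _.
    apply: (card_le_trans (B := I + option J)); last exact/card_eq_le/card_eq_sym.
    by exists inl => i j [].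
  apply: card_le_trans (card_eq_le TE) _; apply: card_le_trans (card_le_trans XK KG).
  by apply: card_le_sumX => //; exact: card_le_optionX.
have [JT1 JT2] := JT; exists G, iota, Q, pi.
split=> //; split=> //; split=> //; split=> //; split; first by move=> /JT1/rank.
split; first by move=> /JT2/rank.
split=> //; split=> //; split=> [phi psi E g|f].
  (* The difference [phi - psi] takes values in [K], so it comes from a homomorphism [G -> K], which
     is zero. *)
  have [|d dE] := @linear_exists R G G (fun g => phi g - psi g).
    by move=> a x y; rewrite (linearP phi) (linearP psi) scalerBr opprD addrACA.
  have dK x : exists k, d x = iota k by apply/pi0; rewrite dE linearB E subrr.
  have [c cE] := choice dK.
  have [|c' c'E] := @linear_exists R G K c.
    by move=> a x y; apply: iotaI; rewrite (linearP iota) -!cE (linearP d).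
  by apply/subr0_eq; rewrite -dE cE -c'E homK linear0.
have [c fE] := homQ f.
have [|phi phiE] := @linear_exists R G G (fun g => c *: g).
  by move=> a x y; rewrite scalerDr !scalerA mulrC.
by exists phi => g; rewrite phiE linearZ /= fE.
Qed.
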